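(* Let $(X,\mathscr{B},\mu)$ be a probability space and let $\tau:X\to X$ be a measurable, invertible, measure preserving point transformation. Let $\rho\ge2$ and let $(n_k)_{k\ge1}$ and $M$ be lacunary sequences of positive integers. Let $f$ be a measurable function on $X$. If $[\,|f(x)|\log|f(x)|\,]^+$ is integrable over $X$, then $\mathcal{O}_\rho(A_nf)$ is integrable over $X$.
   Context: Here $g^+=\max(g,0)$ denotes the positive part of $g$, and $0\log 0=0$. A sequence $(n_k)_{k\ge 1}$ of positive integers is called lacunary if there is a constant $\alpha>1$ such that $n_{k+1}/n_k\ge\alpha$ for all $k\ge 1$; in particular $n_1<n_2<\cdots$. The lacunary sequence $M$ is also regarded as a set of positive integers (the set of its terms). The ergodic averages are $A_nf(x)=\frac1n\sum_{k=1}^nf(\tau^kx)$. The oscillation operator associated with $(n_k)$, $M$ and $\rho$ is $$\mathcal{O}_\rho(A_nf)(x)=\left(\sum_{k=1}^\infty\ \sup_{\substack{n_k\le m<n_{k+1}\\ m\in M}}\left|A_mf(x)-A_{n_k}f(x)\right|^\rho\right)^{1/\rho},$$ where a supremum over an empty set of indices is taken to be $0$. *)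

(* Defs.v *)
From mathcomp Require Import all_boot all_order all_algebra.
From mathcomp Require Import all_classical all_reals all_analysis.
Set Implicit Arguments.
Unset Strict Implicit.
Unset Printing Implicit Defensive.
Import Order.TTheory GRing.Theory Num.Theory.
Import numFieldNormedType.Exports.
Local Open Scope classical_set_scope.
Local Open Scope ring_scope.

(* Sequences are indexed from 0: [u k] is the (k+1)-st term. *)
Definition lacunary (R : realType) (u : nat -> nat) : Prop :=
  (forall k, (0 < u k)%N) /\
  exists2 alpha : R, 1 < alpha & forall k, alpha <= (u k.+1)%:R / (u k)%:R.

Definition measure_preserving d (T : measurableType d) (R : realType)
    (mu : {measure set T -> \bar R}) (tau : T -> T) : Prop :=
  forall A, measurable A -> mu (tau @^-1` A) = mu A.

Definition ergodic_avg (T : Type) (R : realType) (tau : T -> T) (f : T -> R)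
    (n : nat) (x : T) : R :=
  n%:R^-1 * \sum_(1 <= k < n.+1) f (iter k tau x).

(* The supremum runs over finitely many indices and nonnegative reals, so it is
   a maximum, with value 0 when there is no index. The sum may be +oo, hence the
   extended real value. *)
Definition oscillation (T : Type) (R : realType) (a : nat -> T -> R)
    (n_ : nat -> nat) (M : set nat) (rho : R) (x : T) : \bar R :=
  ((\sum_(0 <= k <oo)
      (\big[Num.max/0]_(n_ k <= m < n_ k.+1 | m \in M)
         (`|a m x - a (n_ k) x| `^ rho))%:E) `^ rho^-1)%E.

(* Main.v *)
Require Import Defs.
From mathcomp Require Import all_boot all_order all_algebra.
From mathcomp Require Import all_classical all_reals all_analysis.
From mathcomp Require Import measurable_realfun.
From mathcomp Require Import ring lra zify.
Import Order.TTheory GRing.Theory Num.Theory.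
Import numFieldNormedType.Exports.
Local Open Scope classical_set_scope.
Local Open Scope ring_scope.
Set Implicit Arguments.
Unset Strict Implicit.

(** Since rho >= 2, the l^rho norm defining the oscillation is at most the l^2
    norm, so it is enough to bound, uniformly in K, the integral of the square
    function square_osc built from the first K blocks.  Writing f as the
    difference of v = 1 + f^+ and v' = 1 + f^- (the constants cancel in every
    difference of averages) reduces the problem to a function v >= 1 with
    v ln v integrable.  As tau preserves the measure, averaging over an orbit
    segment of length 2^r transfers the question to sequences phi >= 1 of
    period L = 2^(r+1) (integral_square_osc_le); the statement to prove there is
    sequence_oscillation_LlogL,

      sum_j square_osc(phi)(j) <= C sum_j (phi j + phi j ln (phi j)).

    Let f_s(j) be the average of phi over the dyadic interval of length 2^s
    containing j, and let W(j) be the largest of the values of f_s on the dyadic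
    interval of j and on the next one, over all s.  By the arithmetic-geometric
    inequality, square_osc <= (W + square_osc^2 / W) / 2, so two bounds suffice.

    - The sum of W is at most a constant times the sum of phi + phi ln phi: it is
      at most twice the sum of the dyadic maximal function (sum_adjacent_max_le),
      to which the L log L maximal inequality of Doob applies.

    - The sum of square_osc^2 / W is at most a constant times the sum of
      phi ln phi.  Indeed the weight turns the problem into a quadratic one.  Set
      D = sum_s sum_j (f_s - f_(s+1))^2 / f_(s+1); since the second derivative of
      x ln x is 1/x, D is at most 6 times the sum of phi ln phi
      (sum_dyadic_osc_le), and it remains to compare the sum of square_osc^2 / W
      with D.  For 2^(s-1) <= m < 2^s, the average A_m phi is compared with f_s:
      the error comes from the two ends of the window of length m, and is
      controlled by the quantities low_osc (scales below s) and high_osc (scales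
      above s).  Each obeys a recursion in s that contracts by the factor 3/4, up
      to the contribution of scale s to D, so that their sums over s are at most a
      constant times D.  Lacunarity means that only boundedly many terms of each
      sequence fall in a dyadic block [2^(s-1), 2^s) (lacunary_scale_count), so
      all these errors together cost a constant times D.  What remains is the
      oscillation of the martingale f_s itself over disjoint blocks of scales
      (block_dyadic_osc): dividing each martingale difference by the square root of
      the part of W that comes from the coarser levels gives another martingale,
      whose maximal function obeys the L^2 inequality of Doob and whose energy is
      at most D; summation by parts returns to f_s at the cost of a factor
      proportional to the square root of W. *)

(** * Sums over dyadic intervals *)

Lemma sum_pairs {V : nmodType} (N : nat) (G : nat -> V) :
  \sum_(0 <= n < N.*2) G n = \sum_(0 <= p < N) (G p.*2 + G p.*2.+1).
Proof.
elim: N => [|N IH]; first by rewrite !big_nil.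
by rewrite doubleS !big_nat_recr //= IH addrA.
Qed.

Definition coarsen {R : fieldType} (G : nat -> R) (p : nat) : R :=
  (G p.*2 + G p.*2.+1) / 2.

Lemma divn_expS (j k : nat) : (j %/ 2 ^ k.+1 = (j %/ 2 ^ k)./2)%N.
Proof. by rewrite expnSr divnMA divn2. Qed.

Lemma sum_divn_exp {V : nmodType} (r k : nat) (G : nat -> V) : (k <= r)%N ->
  \sum_(0 <= j < 2 ^ r) G (j %/ 2 ^ k)%N =
  (\sum_(0 <= n < 2 ^ (r - k)) G n) *+ 2 ^ k.
Proof.
elim: k G => [|k IH] G lekr.
  by rewrite subn0 mulr1n; apply: eq_bigr => j _; rewrite divn1.
under eq_bigr do rewrite divn_expS.
rewrite (IH (fun n => G n./2)) ?(ltnW lekr)//.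
have -> : (2 ^ (r - k) = (2 ^ (r - k.+1)).*2)%N.
  by rewrite -(@subnSK k r)// expnS mul2n.
rewrite sum_pairs expnS mulrnA; congr (_ *+ _).
rewrite -sumrMnl; apply: eq_bigr => p _.
by rewrite doubleK /= uphalf_double mulr2n.
Qed.

(** The martingale property in summed form: replacing a function of the level-k
    interval by its average over the two halves of the level-(k+1) interval does
    not change its sum over a period. *)
Lemma sum_coarsen {R : numFieldType} (r k : nat) (G : nat -> R) : (k < r)%N ->
  \sum_(0 <= j < 2 ^ r) G (j %/ 2 ^ k)%N =
  \sum_(0 <= j < 2 ^ r) coarsen G (j %/ 2 ^ k.+1)%N.
Proof.
move=> ltkr; rewrite !sum_divn_exp ?(ltnW ltkr)//.
have -> : (2 ^ (r - k) = (2 ^ (r - k.+1)).*2)%N.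
  by rewrite -(@subnSK k r)// expnS mul2n.
rewrite sum_pairs expnS mulrnA; congr (_ *+ _).
rewrite -sumrMnl; apply: eq_bigr => p _.
by rewrite /coarsen -[RHS]mulr_natr divfK ?pnatr_eq0.
Qed.

Lemma sum_shift {V : nmodType} (r k : nat) (G : nat -> V) : (k <= r)%N ->
  G (2 ^ (r - k))%N = G 0%N ->
  \sum_(0 <= j < 2 ^ r) G (j %/ 2 ^ k).+1 =
  \sum_(0 <= j < 2 ^ r) G (j %/ 2 ^ k)%N.
Proof.
move=> lekr GN; rewrite (sum_divn_exp (fun n => G n.+1))// sum_divn_exp//.
congr (_ *+ _); move: GN; case: (2 ^ (r - k))%N => [|N] GN.
  by rewrite !big_nil.
by rewrite big_nat_recr//= [RHS]big_nat_recl//= GN addrC.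
Qed.

Fixpoint dyadic_avg {R : fieldType} (phi : nat -> R) (k : nat) : nat -> R :=
  if k is k'.+1 then coarsen (dyadic_avg phi k') else phi.

(** The two halves of the level-(k+1) interval p deviate from their common average
    by opposite amounts; this is the square of that deviation, relative to the
    average over p. *)
Definition dyadic_osc {R : fieldType} (phi : nat -> R) (k p : nat) : R :=
  ((dyadic_avg phi k p.*2 - dyadic_avg phi k p.*2.+1) / 2) ^+ 2
  / dyadic_avg phi k.+1 p.

Lemma dyadic_avg_ge1 {R : numFieldType} (phi : nat -> R) k n :
  (forall j, 1 <= phi j) -> 1 <= dyadic_avg phi k n.
Proof.
move=> phi1; elim: k n => [|k IH] n //=.
by rewrite /coarsen ler_pdivlMr// mul1r (_ : 2 = 1 + 1)// lerD.
Qed.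

Lemma dyadic_avg_periodic {R : fieldType} (phi : nat -> R) r k n : (k <= r)%N ->
  (forall j, phi (j + 2 ^ r)%N = phi j) ->
  dyadic_avg phi k (n + 2 ^ (r - k))%N = dyadic_avg phi k n.
Proof.
move=> + per; elim: k n => [|k IH] n lekr; first by rewrite subn0 /=.
have e : (2 ^ (r - k) = (2 ^ (r - k.+1)).*2)%N.
  by rewrite -(@subnSK k r)// expnS mul2n.
by rewrite /= /coarsen doubleD -addSn -e !IH ?(ltnW lekr).
Qed.

(** * The entropy bound for martingale differences *)

(** Taylor expansion of x ln x, whose second derivative is at least 1/(2a) up to
    2a.  With b = a t^2, the inequality ln t >= 1 - 1/t gives
    t^2 ln t^2 - t^2 + 1 >= (t - 1)^2, and (t^2 - 1)^2 = (t + 1)^2 (t - 1)^2 where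
    (t + 1)^2 <= 6 because t^2 <= 2. *)
Lemma entropy_quadratic {R : realType} (a b : R) : 0 < a -> 0 < b ->
  b <= 2 * a ->
  (b - a) ^+ 2 / a <= 6 * (b * ln b - a * ln a - (ln a + 1) * (b - a)).
Proof.
move=> a0 b0 ba.
pose t := Num.sqrt (b / a).
have t0 : 0 < t by rewrite sqrtr_gt0 divr_gt0.
have bE : b = a * t ^+ 2.
  by rewrite sqr_sqrtr ?divr_ge0 ?ltW// mulrCA divff ?mulr1// gt_eqF.
have lnt : 1 - t^-1 <= ln t.
  have /le_ln1Dx : - 1 < t^-1 - 1 by rewrite ltrBrDl addrN invr_gt0.
  by rewrite addrC subrK lnV ?posrE//; lra.
have lnb : ln b = ln a + 2 * ln t.
  by rewrite bE lnM ?posrE ?exprn_gt0// lnXn// mulr_natl.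
have t2 : t ^+ 2 <= 2 by rewrite bE mulrC ler_pM2r in ba.
have tt : t * (1 - t^-1) = t - 1 by rewrite mulrBr mulr1 divff ?gt_eqF.
have h : t - 1 <= t * ln t by rewrite -tt ler_pM2l.
have -> : (b - a) ^+ 2 / a = a * (t ^+ 2 - 1) ^+ 2.
  by rewrite bE; field; rewrite gt_eqF.
have -> : b * ln b - a * ln a - (ln a + 1) * (b - a) =
    a * (2 * t * (t * ln t) - t ^+ 2 + 1) by rewrite lnb bE; ring.
rewrite [6 * (a * _)]mulrCA ler_pM2l//.
apply: (@le_trans _ _ (6 * (t - 1) ^+ 2)).
  have -> : (t ^+ 2 - 1) ^+ 2 = (t + 1) ^+ 2 * (t - 1) ^+ 2 by ring.
  by rewrite ler_wpM2r ?sqr_ge0//; nra.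
rewrite ler_pM2l//; nra.
Qed.

(** The term linear in b - a of the Taylor expansion disappears on averaging over
    the two halves.  The hypothesis b <= 2a is automatic, as a is the mean of two
    positive numbers. *)
Lemma dyadic_osc_le {R : realType} (phi : nat -> R) k p :
  (forall j, 1 <= phi j) ->
  dyadic_osc phi k p <=
  6 * (coarsen (fun n => dyadic_avg phi k n * ln (dyadic_avg phi k n)) p
       - dyadic_avg phi k.+1 p * ln (dyadic_avg phi k.+1 p)).
Proof.
move=> phi1.
have := dyadic_avg_ge1 k p.*2 phi1; have := dyadic_avg_ge1 k p.*2.+1 phi1.
rewrite /dyadic_osc /= /coarsen.
set b := dyadic_avg phi k p.*2; set c := dyadic_avg phi k p.*2.+1 => c1 b1.
set a := (b + c) / 2.
have aE : b + c = 2 * a by rewrite /a; field.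
have a0 : 0 < a by lra.
have /(entropy_quadratic a0) : 0 < b by lra.
have -> : b - a = (b - c) / 2 by rewrite /a; field.
have /(entropy_quadratic a0) : 0 < c by lra.
have -> : c - a = - ((b - c) / 2) by rewrite /a; field.
rewrite sqrrN.
set X := _ / a.
by move=> /(_ ltac:(lra)) h1 /(_ ltac:(lra)) h2; lra.
Qed.

(** Summing over a period, the previous bounds telescope in s; the entropy at the
    coarsest level is nonnegative because all averages are at least 1. *)
Lemma sum_dyadic_osc_le {R : realType} (phi : nat -> R) r :
  (forall j, 1 <= phi j) ->
  \sum_(0 <= s < r) \sum_(0 <= j < 2 ^ r) dyadic_osc phi s (j %/ 2 ^ s.+1)%N <=
  6 * \sum_(0 <= j < 2 ^ r) (phi j * ln (phi j)).
Proof.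
move=> phi1.
pose Phi s := \sum_(0 <= j < 2 ^ r) (dyadic_avg phi s (j %/ 2 ^ s)%N
    * ln (dyadic_avg phi s (j %/ 2 ^ s)%N)).
have Phi_ge0 s : 0 <= Phi s.
  apply: sumr_ge0 => j _; have a1 := dyadic_avg_ge1 s (j %/ 2 ^ s)%N phi1.
  by rewrite mulr_ge0 ?ln_ge0// (le_trans ler01).
have -> : \sum_(0 <= j < 2 ^ r) (phi j * ln (phi j)) = Phi 0%N.
  by apply: eq_bigr => j _; rewrite divn1.
suff H n : (n <= r)%N -> \sum_(0 <= s < n) \sum_(0 <= j < 2 ^ r)
    dyadic_osc phi s (j %/ 2 ^ s.+1)%N <= 6 * (Phi 0%N - Phi n).
  by apply: le_trans (H r (leqnn r)) _; rewrite ler_pM2l// gerBl.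
elim: n => [_|n IH ltnr]; first by rewrite big_nil subrr mulr0.
rewrite big_nat_recr//=.
have : \sum_(0 <= j < 2 ^ r) dyadic_osc phi n (j %/ 2 ^ n.+1)%N <=
    6 * (Phi n - Phi n.+1).
  rewrite /Phi (@sum_coarsen _ r n (fun n0 => dyadic_avg phi n n0
      * ln (dyadic_avg phi n n0)))//.
  by rewrite -sumrB mulr_sumr; apply: ler_sum => j _; exact: dyadic_osc_le.
by have := IH (ltnW ltnr); lra.
Qed.

(** * Dyadic maximal functions *)

(** Dyadic maximal function on the n-th interval of level k, over the levels k to
    k + t.  The recursion starts from the coarsest level, so that the value at
    level k is known once the value at level k+1 is. *)
Fixpoint dyadic_max {R : realFieldType} (phi : nat -> R) (t k n : nat) : R :=
  if t is t'.+1
  then Num.max (dyadic_max phi t' k.+1 n./2) (dyadic_avg phi k n)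
  else dyadic_avg phi k n.

(** Same as the dyadic maximal function, with the next interval of each level
    allowed too: an averaging window that starts at j and is shorter than 2^s
    stays within the level-s interval of j and the following one. *)
Fixpoint adjacent_max {R : realFieldType} (phi : nat -> R) (t k n : nat) : R :=
  let own := Num.max (dyadic_avg phi k n) (dyadic_avg phi k n.+1) in
  if t is t'.+1 then Num.max (adjacent_max phi t' k.+1 n./2) own else own.

Lemma dyadic_avg_le_max {R : realFieldType} (phi : nat -> R) t k n :
  dyadic_avg phi k n <= dyadic_max phi t k n.
Proof. by case: t => [|t] //=; rewrite le_max lexx orbT. Qed.

Lemma avg_le_adjacent_max {R : realFieldType} (phi : nat -> R) t k n :
  dyadic_avg phi k n <= adjacent_max phi t k n.
Proof. by case: t => [|t] /=; rewrite !le_max lexx ?orbT. Qed.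

Lemma avg_succ_le_adjacent_max {R : realFieldType} (phi : nat -> R) t k n :
  dyadic_avg phi k n.+1 <= adjacent_max phi t k n.
Proof. by case: t => [|t] /=; rewrite !le_max lexx ?orbT. Qed.

Lemma adjacent_max_half_le {R : realFieldType} (phi : nat -> R) t k n :
  adjacent_max phi t k.+1 n./2 <= adjacent_max phi t.+1 k n.
Proof. by rewrite /= le_max lexx. Qed.

Lemma adjacent_max_ge1 {R : realFieldType} (phi : nat -> R) t k n :
  (forall j, 1 <= phi j) -> 1 <= adjacent_max phi t k n.
Proof.
by move=> phi1; exact: le_trans (dyadic_avg_ge1 _ _ phi1) (avg_le_adjacent_max _ _ _ _).
Qed.

Lemma half_succ (n : nat) : n.+1./2 = n./2 \/ n.+1./2 = n./2.+1.
Proof. by rewrite /= uphalf_half; case: odd; [right | left]. Qed.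

(** The parent of the interval n+1 is the parent of n or the interval after it. *)
Lemma dyadic_max_le_adjacent {R : realFieldType} (phi : nat -> R) t k n :
  dyadic_max phi t k n <= adjacent_max phi t k n /\
  dyadic_max phi t k n.+1 <= adjacent_max phi t k n.
Proof.
elim: t k n => [|t IH] k n /=.
  by rewrite !le_max !lexx orbT.
have [h1 h2] := IH k.+1 n./2.
rewrite !ge_max !le_max h1 !lexx !orbT /=; split => //.
rewrite !andbT; apply/orP; left.
by have [/= ->|/= ->] := half_succ n.
Qed.

Lemma dyadic_max_periodic {R : realFieldType} (phi : nat -> R) r t k :
  (t + k = r)%N -> (forall j, phi (j + 2 ^ r)%N = phi j) ->
  dyadic_max phi t k (2 ^ t)%N = dyadic_max phi t k 0%N.
Proof.
move=> + per; elim: t k => [|t IH] k tkr.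
  have e : (2 ^ 0 = 0 + 2 ^ (r - k))%N by rewrite (_ : r - k = 0)%N//; lia.
  by rewrite e /= dyadic_avg_periodic//; lia.
rewrite /= expnS mul2n doubleK IH; last by lia.
rewrite -mul2n -expnS (_ : t.+1 = r - k)%N; last by lia.
by rewrite -[(2 ^ _)%N]add0n dyadic_avg_periodic//; lia.
Qed.

(** Passing from level k+1 to level k, the increase of adjacent_max at n is at most
    the sum of the increases of dyadic_max at n and at n+1; the latter has the same
    sum over a period as the former. *)
Lemma sum_adjacent_max_le {R : realFieldType} (phi : nat -> R) r t k :
  (t + k = r)%N -> (forall j, phi (j + 2 ^ r)%N = phi j) ->
  (forall j, 1 <= phi j) ->
  \sum_(0 <= j < 2 ^ r) adjacent_max phi t k (j %/ 2 ^ k)%N <=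
  2 * \sum_(0 <= j < 2 ^ r) dyadic_max phi t k (j %/ 2 ^ k)%N.
Proof.
move=> + per phi1; elim: t k => [|t IH] k tkr.
  rewrite mulr_sumr; apply: ler_sum_nat => j /andP[_ jr] /=.
  have -> : (j %/ 2 ^ k = 0)%N by rewrite divn_small// -(add0n k) tkr.
  have : dyadic_avg phi k 1 = dyadic_avg phi k 0.
    rewrite (_ : 1 = 0 + 2 ^ (r - k))%N ?dyadic_avg_periodic//; first by lia.
    by rewrite (_ : r - k = 0)%N//; lia.
  by move=> ->; rewrite maxxx; have := dyadic_avg_ge1 k 0 phi1; lra.
have kr : (k < r)%N by lia.
(* The intervals of n and n+1 at coarser levels are covered by the maximum over
   the parent of n and its successor. *)
have pw n : adjacent_max phi t.+1 k n <= adjacent_max phi t k.+1 n./2 +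
    (dyadic_max phi t.+1 k n - dyadic_max phi t k.+1 n./2) +
    (dyadic_max phi t.+1 k n.+1 - dyadic_max phi t k.+1 n.+1./2).
  have [h1 h2] := dyadic_max_le_adjacent phi t k.+1 n./2.
  have h3 : dyadic_max phi t k.+1 n.+1./2 <= adjacent_max phi t k.+1 n./2.
    by have [->|->] := half_succ n.
  move: h1 h3 => /=.
  move: (dyadic_max phi t k.+1 _) (dyadic_max phi t k.+1 _) => F F' h1 h3.
  move: (dyadic_avg _ _ _) (dyadic_avg _ _ _) => x y.
  have : F <= Num.max F x by rewrite le_max lexx.
  have : x <= Num.max F x by rewrite le_max lexx orbT.
  have : F' <= Num.max F' y by rewrite le_max lexx.
  have : y <= Num.max F' y by rewrite le_max lexx orbT.
  by rewrite !ge_max; move=> *; apply/andP; split; [|apply/andP; split]; lra.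
have shift := @sum_shift _ r k (fun n => dyadic_max phi t.+1 k n
    - dyadic_max phi t k.+1 n./2).
have {shift}shift : \sum_(0 <= j < 2 ^ r) (dyadic_max phi t.+1 k (j %/ 2 ^ k).+1
    - dyadic_max phi t k.+1 (j %/ 2 ^ k).+1./2) =
    \sum_(0 <= j < 2 ^ r) (dyadic_max phi t.+1 k (j %/ 2 ^ k)%N
        - dyadic_max phi t k.+1 (j %/ 2 ^ k)./2).
  apply: shift; first exact: ltnW.
  have -> : (r - k = t.+1)%N by lia.
  rewrite (dyadic_max_periodic tkr)//; congr (_ - _).
  by rewrite expnS mul2n doubleK (@dyadic_max_periodic _ phi r)//; lia.
apply: le_trans (ler_sum _ (fun j _ => pw (j %/ 2 ^ k)%N)) _.
have half G : \sum_(0 <= j < 2 ^ r) G (j %/ 2 ^ k.+1)%N =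
    \sum_(0 <= j < 2 ^ r) G (j %/ 2 ^ k)./2 :> R.
  by apply: eq_bigr => j _; rewrite divn_expS.
have := IH k.+1 ltac:(lia); rewrite !half.
rewrite [X in _ -> X <= _]big_split [X in _ -> X + _ <= _]big_split
    [in X in _ -> X]/= shift sumrB.
lra.
Qed.

(** Pathwise form of the maximal inequality of Doob.  With F the maximal function
    and a the average, the sum of F - a ln F decreases towards finer levels: where F
    increases, its new value is a, and F' - a ln F' <= F - a ln F at F' = a because
    ln (F/a) <= F/a - 1. *)
Lemma sum_dyadic_max_potential {R : realType} (phi : nat -> R) r t k :
  (t + k = r)%N -> (forall j, 1 <= phi j) ->
  \sum_(0 <= j < 2 ^ r) (dyadic_max phi t k (j %/ 2 ^ k)%N
    - dyadic_avg phi k (j %/ 2 ^ k)%N * ln (dyadic_max phi t k (j %/ 2 ^ k)%N))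
  <= \sum_(0 <= j < 2 ^ r) dyadic_avg phi k (j %/ 2 ^ k)%N.
Proof.
move=> + phi1; elim: t k => [|t IH] k tkr.
  apply: ler_sum => j _ /=; have a1 := dyadic_avg_ge1 k (j %/ 2 ^ k) phi1.
  by rewrite lerBlDr lerDl mulr_ge0 ?ln_ge0// (le_trans ler01).
have kr : (k < r)%N by lia.
rewrite [leRHS](@sum_coarsen _ r k (fun n => dyadic_avg phi k n))//.
apply: le_trans (IH k.+1 _); last by lia.
rewrite (@sum_coarsen _ r k (fun n => dyadic_max phi t.+1 k n
    - dyadic_avg phi k n * ln (dyadic_max phi t.+1 k n)))//.
apply: ler_sum => j _; move: (_ %/ _)%N => p.
(* Either the maximum is unchanged, or it becomes the average itself. *)
have pw n : dyadic_max phi t.+1 k n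
    - dyadic_avg phi k n * ln (dyadic_max phi t.+1 k n) <=
    dyadic_max phi t k.+1 n./2 - dyadic_avg phi k n * ln (dyadic_max phi t k.+1 n./2).
  rewrite /=.
  have a1 := dyadic_avg_ge1 k n phi1.
  have F1 : 1 <= dyadic_max phi t k.+1 n./2.
    by apply: le_trans (dyadic_avg_le_max _ _ _ _); exact: dyadic_avg_ge1.
  case: (leP (dyadic_avg phi k n)) => // Fa.
  move: (dyadic_max _ _ _ _) (dyadic_avg _ _ _) F1 a1 Fa => F a F1 a1 Fa.
  have lnFa : ln F - ln a <= F / a - 1.
    have Fa0 : 0 < F / a by apply: divr_gt0; lra.
    have /le_ln1Dx : - 1 < F / a - 1 by lra.
    by rewrite [1 + _]addrC subrK ln_div ?posrE; lra.
  have : a * (ln F - ln a) <= a * (F / a - 1) by apply: ler_wpM2l => //; lra.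
  have -> : a * (F / a - 1) = F - a by field; rewrite gt_eqF//; lra.
  lra.
have := pw p.*2; have := pw p.*2.+1.
by rewrite /coarsen [p.*2.+1./2]uphalf_double doubleK
    [dyadic_avg phi k.+1 p]/=/coarsen; lra.
Qed.

(** In the potential inequality, a ln F <= a ln a + F/2, and the term F/2 is
    absorbed on the left. *)
Lemma sum_adjacent_max_LlogL {R : realType} (phi : nat -> R) r :
  (forall j, phi (j + 2 ^ r)%N = phi j) -> (forall j, 1 <= phi j) ->
  \sum_(0 <= j < 2 ^ r) adjacent_max phi r 0 j <=
  4 * \sum_(0 <= j < 2 ^ r) (phi j + phi j * ln (phi j)).
Proof.
move=> per phi1.
have := sum_adjacent_max_le (addn0 r) per phi1.
have := sum_dyadic_max_potential (addn0 r) phi1.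
under eq_bigr do rewrite divn1.
under [X in _ <= X -> _]eq_bigr do rewrite divn1.
under [X in _ -> X <= _ -> _]eq_bigr do rewrite divn1.
under [X in _ -> _ <= 2 * X -> _]eq_bigr do rewrite divn1.
move=> h1 h2.
have : \sum_(0 <= j < 2 ^ r) (dyadic_max phi r 0 j
    - phi j * ln (dyadic_max phi r 0 j)) >=
  \sum_(0 <= j < 2 ^ r) (dyadic_max phi r 0 j * 2^-1 - phi j * ln (phi j)).
  apply: ler_sum => j _; have := dyadic_avg_le_max phi r 0 j; have := phi1 j => /=.
  move: (dyadic_max _ _ _ _) (phi j) => F a a1 Fa.
  have Fa0 : 0 < F / a by apply: divr_gt0; lra.
  have /le_ln1Dx : - 1 < F / a / 2 - 1 by lra.
  rewrite [1 + _]addrC subrK !ln_div ?posrE//; try lra.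
  have ln2 : ln (2 : R) <= 1 by have := @le_ln1Dx R 1; rewrite (_ : 1 + 1 = 2)//;
      apply; lra.
  move=> h3.
  have : a * (ln F - ln a) <= a * (F / a / 2) by apply: ler_wpM2l; lra.
  have -> : a * (F / a / 2) = F / 2 by field; rewrite gt_eqF//; lra.
  lra.
rewrite !sumrB -mulr_suml !big_split/= in h1 *; lra.
Qed.

(** * Comparing partial sums with dyadic averages *)

(** Partial sums of the part of phi at scales below s.  They may start at 0 instead
    of at the beginning of the interval of j, because this part has total 0 on every
    level-s interval. *)
Definition dyadic_excess {R : fieldType} (phi : nat -> R) (s j : nat) : R :=
  \sum_(0 <= t < j) (phi t - dyadic_avg phi s (t %/ 2 ^ s)%N).

Lemma dyadic_excessS {R : fieldType} (phi : nat -> R) s j :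
  dyadic_excess phi s j.+1 =
  dyadic_excess phi s j + (phi j - dyadic_avg phi s (j %/ 2 ^ s)%N).
Proof. by rewrite /dyadic_excess big_nat_recr. Qed.

(** The difference of consecutive excesses is a sum of martingale differences at
    one scale: a tent that grows with slope d over the first half of each
    level-(s+1) interval and returns to 0 over the second half. *)
Lemma dyadic_excess_step {R : numFieldType} (phi : nat -> R) s j :
  dyadic_excess phi s.+1 j - dyadic_excess phi s j =
  (minn (j %% 2 ^ s.+1) (2 ^ s.+1 - j %% 2 ^ s.+1))%:R *
  ((dyadic_avg phi s (j %/ 2 ^ s.+1).*2 - dyadic_avg phi s (j %/ 2 ^ s.+1).*2.+1) / 2).
Proof.
elim: j => [|j IH].
  by rewrite /dyadic_excess !big_nil mod0n min0n subrr mul0r.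
rewrite !dyadic_excessS.
set U := dyadic_excess phi s.+1 j in IH *; set V := dyadic_excess phi s j in IH *.
rewrite [LHS](_ : _ = (U - V) + (dyadic_avg phi s (j %/ 2 ^ s)%N
    - dyadic_avg phi s.+1 (j %/ 2 ^ s.+1)%N)); last by ring.
rewrite {}IH {U V} [dyadic_avg phi s.+1 _]/=.
have Ngt0 : (0 < 2 ^ s)%N by rewrite expn_gt0.
have e2 : (2 ^ s.+1 = (2 ^ s).*2)%N by rewrite expnS mul2n.
rewrite e2; move: (2 ^ s)%N Ngt0 => N N0 {e2}.
have := divn_eq j N.*2; have : (j %% N.*2 < N.*2)%N by rewrite ltn_mod double_gt0.
move: (j %/ N.*2)%N (j %% N.*2)%N => p q qN jE.
have jN : (j %/ N)%N = (if (q < N)%N then p.*2 else p.*2.+1).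
  case: ltnP => h.
    rewrite jE (_ : p * N.*2 + q = p.*2 * N + q)%N; last by lia.
    by rewrite divnMDl// divn_small// addn0.
  rewrite jE (_ : p * N.*2 + q = p.*2.+1 * N + (q - N))%N; last by lia.
  by rewrite divnMDl// divn_small ?addn0//; lia.
rewrite {}jN /coarsen.
move: (dyadic_avg phi s) => a.
have [h|h] := ltnP q.+1 N.*2.
  have -> : (j.+1 %/ N.*2)%N = p.
    by rewrite jE -addnS divnMDl ?double_gt0// divn_small// addn0.
  have -> : (j.+1 %% N.*2)%N = q.+1 by rewrite jE -addnS modnMDl modn_small.
  have [h1|h1] := ltnP q N.
    have -> : (minn q (N.*2 - q) = q)%N by lia.
    have -> : (minn q.+1 (N.*2 - q.+1) = q.+1)%N by lia.
    by rewrite -natr1; field.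
  have -> : (minn q (N.*2 - q) = (N.*2 - q.+1).+1)%N by lia.
  have -> : (minn q.+1 (N.*2 - q.+1) = N.*2 - q.+1)%N by lia.
  by rewrite -natr1; field.
have -> : (j.+1 %% N.*2)%N = 0%N.
  by rewrite jE -addnS (_ : q.+1 = N.*2) ?modnMDl ?modnn//; lia.
rewrite min0n mul0r (_ : minn _ _ = 1)%N; last by lia.
rewrite ifF; last by apply/negbTE; lia.
by field.
Qed.

(** Weighted energy, at level s, of the normalized partial sums of the part of phi at
    scales below s: the boundary effect of small scales on an average of length about
    2^s. *)
Definition low_osc {R : fieldType} (phi : nat -> R) (r s : nat) : R :=
  \sum_(0 <= j < 2 ^ r)
    (dyadic_excess phi s j / (2 ^ s)%:R) ^+ 2 / dyadic_avg phi s (j %/ 2 ^ s)%N.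

(** Weighted energy of the differences between adjacent level-s averages: the error made
    when a window of length about 2^s crosses into the next interval. *)
Definition high_osc {R : realFieldType} (phi : nat -> R) (r s : nat) : R :=
  \sum_(0 <= j < 2 ^ r)
    (dyadic_avg phi s (j %/ 2 ^ s).+1 - dyadic_avg phi s (j %/ 2 ^ s)%N) ^+ 2
    / adjacent_max phi (r - s) s (j %/ 2 ^ s)%N.

Lemma dyadic_avg_half_le {R : realFieldType} (phi : nat -> R) s n :
  (forall j, 1 <= phi j) ->
  dyadic_avg phi s n <= 2 * dyadic_avg phi s.+1 n./2.
Proof.
move=> phi1 /=; rewrite /coarsen mulrCA divff// mulr1.
have h m := dyadic_avg_ge1 s m phi1.
rewrite -[in leLHS](odd_double_half n); case: odd => /=; rewrite ?add1n ?add0n.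
  by rewrite lerDr (le_trans ler01).
by rewrite lerDl (le_trans ler01).
Qed.

(** By the tent formula the normalized excess at level s+1 is half of the one at
    level s, up to half a martingale difference.  The square of the factor 1/2,
    the factor 2 lost in passing from the average at level s to the one at level
    s+1, and the factor 3/2 from expanding the square multiply to 3/4. *)
Lemma low_osc_step {R : realFieldType} (phi : nat -> R) r s :
  (forall j, 1 <= phi j) ->
  low_osc phi r s.+1 <= 3 / 4 * (low_osc phi r s
    + \sum_(0 <= j < 2 ^ r) dyadic_osc phi s (j %/ 2 ^ s.+1)%N).
Proof.
move=> phi1; rewrite /low_osc -big_split/= mulr_sumr; apply: ler_sum => j _.
have step := dyadic_excess_step phi s j.
have a2 := dyadic_avg_half_le s (j %/ 2 ^ s)%N phi1.
rewrite -divn_expS in a2.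
have a1 := dyadic_avg_ge1 s.+1 (j %/ 2 ^ s.+1)%N phi1.
have a0 := dyadic_avg_ge1 s (j %/ 2 ^ s)%N phi1.
rewrite /dyadic_osc -/(dyadic_avg phi s.+1 (j %/ 2 ^ s.+1)%N)
    -[X in _ / X <= _]/(dyadic_avg phi s.+1 (j %/ 2 ^ s.+1)%N).
set d := (_ - _) / 2 in step *.
set m := minn _ _ in step.
have mN : (m%:R <= (2 ^ s)%:R :> R).
  by rewrite ler_nat /m expnS; lia.
have N0 : 0 < (2 ^ s)%:R :> R by rewrite ltr0n expn_gt0.
have -> : ((2 ^ s.+1)%:R = 2 * (2 ^ s)%:R :> R) by rewrite expnS natrM.
have -> : dyadic_excess phi s.+1 j =
    dyadic_excess phi s j + m%:R * d by rewrite -step; ring.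
move: a2 a1 a0 mN N0 {step}; move: (dyadic_avg phi s.+1 _) (dyadic_avg phi s _)
    (dyadic_excess _ _ _) => A a U.
move: (2 ^ s)%:R => N; have : 0 <= m%:R :> R by [].
move: m%:R => x x0 a2 A1 a1 xN N0.
(* In normalized form: g is the excess at level s, y d the height of the tent. *)
pose g := U / N; pose y := x / N.
have y0 : 0 <= y by rewrite divr_ge0// ltW.
have y1 : y <= 1 by rewrite ler_pdivrMr// mul1r.
have -> : (U + x * d) / (2 * N) = (g + y * d) / 2.
  by rewrite /g /y; field; rewrite gt_eqF.
rewrite -/g.
apply: (@le_trans _ _ ((3 / 8 * g ^+ 2 + 3 / 4 * d ^+ 2) / A)).
  rewrite ler_pM2r ?invr_gt0; last by lra.
  have yd : (y * d) ^+ 2 <= d ^+ 2.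
    by rewrite exprMn ler_piMl ?sqr_ge0// expr_le1.
  have := sqr_ge0 (g - 2 * (y * d)).
  by rewrite !expr2 in yd *; nra.
rewrite mulrDl mulrDr; apply: lerD; last by lra.
have h : A^-1 <= 2 / a.
  rewrite ler_pdivlMr; last by lra.
  by rewrite mulrC ler_pdivrMr; lra.
apply: (@le_trans _ _ (3 / 8 * g ^+ 2 * (2 / a))).
  by rewrite ler_wpM2l// mulr_ge0 ?sqr_ge0//; lra.
by lra.
Qed.

(** Adjacent level-s intervals are either siblings, and then only a martingale
    difference separates their averages, or have adjacent parents.  The latter holds
    for half of them, which gives the factor 1/2; expanding the square costs 3/2. *)
Lemma high_osc_step {R : realFieldType} (phi : nat -> R) r s : (s < r)%N ->
  (forall j, phi (j + 2 ^ r)%N = phi j) -> (forall j, 1 <= phi j) ->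
  high_osc phi r s <= 3 / 4 * high_osc phi r s.+1
    + 8 * \sum_(0 <= j < 2 ^ r) dyadic_osc phi s (j %/ 2 ^ s.+1)%N.
Proof.
move=> sr per phi1; rewrite /high_osc.
rewrite (@sum_coarsen _ r s (fun n => (dyadic_avg phi s n.+1 - dyadic_avg phi s n) ^+ 2
    / adjacent_max phi (r - s) s n))//.
have shift : \sum_(0 <= j < 2 ^ r) dyadic_osc phi s (j %/ 2 ^ s.+1).+1 =
    \sum_(0 <= j < 2 ^ r) dyadic_osc phi s (j %/ 2 ^ s.+1)%N.
  apply: sum_shift => //; rewrite /dyadic_osc.
  have e : (2 ^ (r - s.+1)).*2 = (2 ^ (r - s))%N.
    by rewrite -mul2n -expnS subnSK.
  rewrite e -[(2 ^ (r - s))%N]add0n -addSn !dyadic_avg_periodic ?(ltnW sr)//.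
  by rewrite -[(2 ^ (r - s.+1))%N]add0n !dyadic_avg_periodic.
rewrite (_ : 8 * _ = 3 * \sum_(0 <= j < 2 ^ r) dyadic_osc phi s (j %/ 2 ^ s.+1).+1 +
  5 * \sum_(0 <= j < 2 ^ r) dyadic_osc phi s (j %/ 2 ^ s.+1)%N);
      last by rewrite shift; ring.
rewrite !mulr_sumr -!big_split/=; apply: ler_sum => j _.
move: (j %/ 2 ^ s.+1)%N => p.
rewrite /coarsen /dyadic_osc.
have rs : (r - s = (r - s.+1).+1)%N by lia.
have W1 n : n./2 = p -> adjacent_max phi (r - s.+1) s.+1 p <=
    adjacent_max phi (r - s) s n.
  by move=> <-; rewrite rs; exact: adjacent_max_half_le.
have {W1} [W1 W2] := (W1 _ (doubleK p), W1 p.*2.+1 (uphalf_double p)).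
have A1 := avg_le_adjacent_max phi (r - s.+1) s.+1 p.
have A2 := avg_succ_le_adjacent_max phi (r - s.+1) s.+1 p.
have a1 := dyadic_avg_ge1 s.+1 p phi1.
have a2 := dyadic_avg_ge1 s.+1 p.+1 phi1.
have e1 : dyadic_avg phi s.+1 p =
    (dyadic_avg phi s p.*2 + dyadic_avg phi s p.*2.+1) / 2 by [].
have e2 : dyadic_avg phi s.+1 p.+1 =
    (dyadic_avg phi s p.*2.+2 + dyadic_avg phi s p.*2.+3) / 2 by [].
rewrite doubleS; move: e1 e2 A1 A2 a1 a2 W1 W2.
move: (adjacent_max _ _ _ p) (adjacent_max _ _ _ p.*2) (adjacent_max _ _ _ p.*2.+1)
    => W V1 V2.
move: (dyadic_avg phi s.+1 p) (dyadic_avg phi s.+1 p.+1) => a a'.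
move: (dyadic_avg phi s p.*2) (dyadic_avg phi s p.*2.+1) (dyadic_avg phi s p.*2.+2)
    (dyadic_avg phi s p.*2.+3) => x1 x2 y1 y2.
move=> e1 e2 A1 A2 a1 a2 W1 W2.
have [d dE] : {d | d = (x1 - x2) / 2} by exists ((x1 - x2) / 2).
have [d' dE'] : {d' | d' = (y1 - y2) / 2} by exists ((y1 - y2) / 2).
have sqr_le3 (u v w : R) : (u + (v + w)) ^+ 2 <=
    3 / 2 * u ^+ 2 + 6 * v ^+ 2 + 6 * w ^+ 2.
  by have := sqr_ge0 (u - 2 * (v + w)); have := sqr_ge0 (v - w); nra.
have inv_le (u v z : R) : 1 <= u -> u <= v -> z ^+ 2 / v <= z ^+ 2 / u.
  by move=> u1 uv; rewrite ler_wpM2l ?sqr_ge0// lef_pV2 ?posrE//; lra.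
(* Siblings: their averages differ by twice the deviation d. *)
have h1 : (x2 - x1) ^+ 2 / V1 <= 4 * (d ^+ 2 / a).
  have -> : 4 * (d ^+ 2 / a) = (x2 - x1) ^+ 2 / a by rewrite dE; field;
      rewrite gt_eqF//; lra.
  by apply: inv_le; lra.
(* Adjacent intervals with different parents. *)
have h2 : (y1 - x2) ^+ 2 / V2 <= 3 / 2 * ((a' - a) ^+ 2 / W) + 6 * (d' ^+ 2 / a')
    + 6 * (d ^+ 2 / a).
  apply: (@le_trans _ _ ((y1 - x2) ^+ 2 / W)); first by apply: inv_le; lra.
  have k1 := inv_le _ _ d a1 A1; have k2 := inv_le _ _ d' a2 A2.
  apply: (@le_trans _ _ (3 / 2 * ((a' - a) ^+ 2 / W) + 6 * (d' ^+ 2 / W)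
      + 6 * (d ^+ 2 / W))); last by lra.
  have W0 : 0 <= W^-1 by rewrite invr_ge0; lra.
  have -> : y1 - x2 = (a' - a) + (d' + d) by rewrite e1 e2 dE dE'; field.
  have := ler_wpM2r W0 (sqr_le3 (a' - a) d' d); by rewrite 2!mulrDl !mulrA.
by rewrite -dE -dE' -e1 -e2; lra.
Qed.

(** Summing the contracting recursion, which starts from low_osc phi r 0 = 0. *)
Lemma sum_low_osc_le {R : realFieldType} (phi : nat -> R) r :
  (forall j, 1 <= phi j) ->
  \sum_(0 <= s < r.+1) low_osc phi r s <= 3 *
   \sum_(0 <= s < r) \sum_(0 <= j < 2 ^ r) dyadic_osc phi s (j %/ 2 ^ s.+1)%N.
Proof.
move=> phi1.
have L0 : low_osc phi r 0 = 0.
  apply: big1 => j _; rewrite (_ : dyadic_excess _ _ _ = 0) ?mul0r ?expr0n ?mul0r//.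
  by apply: big1 => t _; rewrite divn1 subrr.
have pos s : 0 <= low_osc phi r s.
  by apply: sumr_ge0 => j _; rewrite divr_ge0 ?sqr_ge0// (le_trans ler01)
      ?dyadic_avg_ge1.
rewrite big_nat_recl// L0 add0r.
have : \sum_(0 <= s < r) low_osc phi r s.+1 <=
    \sum_(0 <= s < r) (3 / 4 * (low_osc phi r s
    + \sum_(0 <= j < 2 ^ r) dyadic_osc phi s (j %/ 2 ^ s.+1)%N)).
  by apply: ler_sum => s _; exact: low_osc_step.
rewrite -mulr_sumr big_split/=.
have : \sum_(0 <= s < r) low_osc phi r s <= \sum_(0 <= s < r) low_osc phi r s.+1.
  have : \sum_(0 <= s < r.+1) low_osc phi r s = \sum_(0 <= s < r) low_osc phi r s.+1.
    by rewrite big_nat_recl// L0 add0r.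
  by move=> <-; rewrite big_nat_recr//= lerDl.
lra.
Qed.

(** Summing the contracting recursion from the coarsest level, where periodicity
    makes the oscillation vanish. *)
Lemma sum_high_osc_le {R : realFieldType} (phi : nat -> R) r :
  (forall j, phi (j + 2 ^ r)%N = phi j) -> (forall j, 1 <= phi j) ->
  \sum_(0 <= s < r.+1) high_osc phi r s <= 32 *
   \sum_(0 <= s < r) \sum_(0 <= j < 2 ^ r) dyadic_osc phi s (j %/ 2 ^ s.+1)%N.
Proof.
move=> per phi1.
have pos s : 0 <= high_osc phi r s.
  by apply: sumr_ge0 => j _; rewrite divr_ge0 ?sqr_ge0// (le_trans ler01)
      ?adjacent_max_ge1.
have Lr : high_osc phi r r = 0.
  rewrite /high_osc big_nat; apply: big1 => j /= jr.
  have e := @dyadic_avg_periodic _ phi r r 0 (leqnn r) per.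
  by rewrite subnn in e; rewrite divn_small// e subrr expr0n mul0r.
rewrite big_nat_recr//= Lr addr0.
have : \sum_(0 <= s < r) high_osc phi r s <=
    \sum_(0 <= s < r) (3 / 4 * high_osc phi r s.+1
    + 8 * \sum_(0 <= j < 2 ^ r) dyadic_osc phi s (j %/ 2 ^ s.+1)%N).
  by apply: ler_sum_nat => s /andP[_ sr]; exact: high_osc_step.
rewrite big_split/= -!mulr_sumr.
have : \sum_(0 <= s < r) high_osc phi r s.+1 <= \sum_(0 <= s < r) high_osc phi r s.
  have : \sum_(0 <= s < r.+1) high_osc phi r s = \sum_(0 <= s < r) high_osc phi r s.
    by rewrite big_nat_recr//= Lr addr0.
  by move=> <-; rewrite big_nat_recl//= lerDr.
lra.
Qed.

(** * One-sided averages against dyadic averages *)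

Definition forward_avg {R : fieldType} (phi : nat -> R) (m j : nat) : R :=
  m%:R^-1 * \sum_(1 <= i < m.+1) phi (i + j)%N.

Lemma divn_add_near (N j d : nat) : (d <= N)%N -> (0 < N)%N ->
  ((j + d) %/ N = j %/ N \/ (j + d) %/ N = (j %/ N).+1)%N.
Proof.
move=> dN N0; have := divn_eq j N; have := ltn_pmod j N0.
move: (j %/ N)%N (j %% N)%N => p q qN jE.
rewrite jE -addnA divnMDl//; have [h|h] := ltnP (q + d) N.
  by left; rewrite divn_small// addn0.
right; rewrite (_ : q + d = 1 * N + (q + d - N))%N; last by lia.
by rewrite divnMDl// divn_small ?addn0 ?addn1//; lia.
Qed.

Lemma adjacent_max_divn_le {R : realFieldType} (phi : nat -> R) i t k n :
  adjacent_max phi t (k + i) (n %/ 2 ^ i)%N <= adjacent_max phi (t + i) k n.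
Proof.
elim: i k n => [|i IH] k n; first by rewrite !addn0 divn1.
rewrite (addnS t i) expnS divnMA divn2.
apply: le_trans (adjacent_max_half_le phi (t + i) k n).
by rewrite (_ : k + i.+1 = k.+1 + i)%N ?IH//; lia.
Qed.

Lemma sum_translate_le {R : numDomainType} (F : nat -> R) (H d N : nat) :
  (forall j, 0 <= F j) -> (H + d <= N)%N ->
  \sum_(0 <= j < H) F (j + d)%N <= \sum_(0 <= j < N) F j.
Proof.
move=> F0 HN.
have -> : \sum_(0 <= j < H) F (j + d)%N = \sum_(d <= j < H + d) F j.
  by rewrite -[in RHS](add0n d) big_addn addnK.
rewrite (@big_cat_nat _ _ _ d 0 N)//=; last by lia.
rewrite (@big_cat_nat _ _ _ (H + d) d N)//=; last by lia.
rewrite addrCA lerDl addr_ge0// sumr_ge0//.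
Qed.

Lemma sum_prefix_le {R : numDomainType} (F : nat -> R) (H N : nat) :
  (forall j, 0 <= F j) -> (H <= N)%N ->
  \sum_(0 <= j < H) F j <= \sum_(0 <= j < N) F j.
Proof.
by move=> F0 HN; rewrite [leRHS](@big_cat_nat _ _ _ H)//= lerDl sumr_ge0.
Qed.

Lemma sum_excess {R : fieldType} (phi : nat -> R) s m j :
  \sum_(1 <= i < m.+1) (phi (i + j)%N - dyadic_avg phi s ((i + j) %/ 2 ^ s)%N) =
  dyadic_excess phi s (j + m.+1) - dyadic_excess phi s j.+1.
Proof.
elim: m => [|m IH]; first by rewrite big_geq// addn1 subrr.
rewrite big_nat_recr//= IH (addnS j m.+1) (dyadic_excessS phi s (j + m.+1))
    (addnC j m.+1).
ring.
Qed.

(** The scales below s contribute to the window sum only through the excess at its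
    two ends; the averages at level s take at most two values in the window, those
    at the interval of j and at the next one. *)
Lemma forward_avg_sub_dyadic_sqr {R : realFieldType} (phi : nat -> R) s m j :
  (0 < m)%N -> (m < 2 ^ s)%N -> (2 ^ s <= m.*2)%N ->
  (forward_avg phi m j - dyadic_avg phi s (j %/ 2 ^ s)%N) ^+ 2 <=
  16 * (dyadic_excess phi s (j + m.+1) / (2 ^ s)%:R) ^+ 2 +
  16 * (dyadic_excess phi s (j + 1) / (2 ^ s)%:R) ^+ 2 +
  2 * (dyadic_avg phi s (j %/ 2 ^ s).+1 - dyadic_avg phi s (j %/ 2 ^ s)%N) ^+ 2.
Proof.
move=> m0 ms sm.
have m0' : 0 < m%:R :> R by rewrite ltr0n.
set a0 := dyadic_avg phi s (j %/ 2 ^ s)%N; set b := dyadic_avg phi s _ - a0.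
set c := m%:R^-1 * \sum_(1 <= i < m.+1) (dyadic_avg phi s ((i + j) %/ 2 ^ s)%N - a0).
have cb : `|c| <= `|b|.
  rewrite /c normrM normfV [`|m%:R|]gtr0_norm// ler_pdivrMl//.
  apply: le_trans (ler_norm_sum _ _ _) _.
  apply: (@le_trans _ _ (\sum_(1 <= i < m.+1) `|b|)).
    apply: ler_sum_nat => i /andP[_ im].
    rewrite addnC; have [||->|->] := @divn_add_near (2 ^ s) j i; rewrite ?expn_gt0//.
      by lia.
    by rewrite subrr normr0.
  by rewrite sumr_const_nat subSS subn0 mulr_natl.
have -> : forward_avg phi m j - a0 =
    m%:R^-1 * (dyadic_excess phi s (j + m.+1) - dyadic_excess phi s (j + 1)) + c.
  rewrite addn1 -sum_excess /c -mulrDr -big_split/= /forward_avg.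
  have a0E : a0 = m%:R^-1 * \sum_(1 <= i < m.+1) a0.
    by rewrite sumr_const_nat subSS subn0 -[a0 *+ m]mulr_natl mulrA mulVf ?mul1r//
        gt_eqF.
  rewrite [X in _ - X = _]a0E -mulrBr -sumrB; congr (_ * _); apply: eq_bigr => i _.
  by ring.
have c2 : c ^+ 2 <= b ^+ 2 by rewrite -[c ^+ 2]real_normK ?num_real//
    -[leRHS]real_normK ?num_real// lerXn2r ?nnegrE.
move: (dyadic_excess phi s (j + m.+1)) (dyadic_excess phi s (j + 1)) => x y.
have N0 : 0 < (2 ^ s)%:R :> R by rewrite ltr0n expn_gt0.
have Nm : (2 ^ s)%:R <= 2 * m%:R :> R by rewrite -natrM ler_nat mul2n.
move: c2; move: (c) (b) => {cb}{}c {}b c2.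
move: (2 ^ s)%:R (m%:R : R) m0' N0 Nm => N M M0 N0 NM.
have -> : M^-1 * (x - y) = (N / M) * ((x - y) / N).
  by field; rewrite !gt_eqF.
have -> : (x - y) / N = x / N - y / N by rewrite mulrBl.
have k0 : 0 <= N / M by rewrite divr_ge0// ltW.
have k2 : N / M <= 2 by rewrite ler_pdivrMr.
move: (N / M) (x / N) (y / N) k0 k2 => k u v k0 k2.
have h1 : (k * (u - v) + c) ^+ 2 <= 2 * (k * (u - v)) ^+ 2 + 2 * c ^+ 2.
  by have := sqr_ge0 (k * (u - v) - c); nra.
have h2 : (k * (u - v)) ^+ 2 <= 4 * (u - v) ^+ 2.
  by rewrite exprMn ler_wpM2r ?sqr_ge0//; nra.
have := sqr_ge0 (u + v); nra.
Qed.

(** The weight at j dominates the averages over the intervals of both ends of the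
    window, so each excess can be paired with the weight at its own position, and
    translated. *)
Lemma sum_forward_avg_sub_dyadic {R : realFieldType} (phi : nat -> R) r s m H :
  (forall j, 1 <= phi j) -> (s <= r)%N ->
  (0 < m)%N -> (m < 2 ^ s)%N -> (2 ^ s <= m.*2)%N -> (H + m.+1 <= 2 ^ r)%N ->
  \sum_(0 <= j < H)
    (forward_avg phi m j - dyadic_avg phi s (j %/ 2 ^ s)%N) ^+ 2
    / adjacent_max phi r 0 j <= 32 * low_osc phi r s + 2 * high_osc phi r s.
Proof.
move=> phi1 sr m0 ms sm Hm.
pose P j := (dyadic_excess phi s j / (2 ^ s)%:R) ^+ 2 / dyadic_avg phi s (j %/ 2 ^ s)%N.
have a1 n := dyadic_avg_ge1 s n phi1.
have P0 j : 0 <= P j by rewrite divr_ge0 ?sqr_ge0// (le_trans ler01).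
have l1 : \sum_(0 <= j < H) P (j + m.+1)%N <=
    low_osc phi r s by exact: sum_translate_le.
have l2 : \sum_(0 <= j < H) P (j + 1)%N <= low_osc phi r s.
  by apply: sum_translate_le => //; lia.
pose Q j := (dyadic_avg phi s (j %/ 2 ^ s).+1 - dyadic_avg phi s (j %/ 2 ^ s)%N) ^+ 2
    / adjacent_max phi (r - s) s (j %/ 2 ^ s)%N.
have Q0 j : 0 <= Q j.
  by rewrite divr_ge0 ?sqr_ge0// (le_trans ler01) ?adjacent_max_ge1.
have l3 : \sum_(0 <= j < H) Q j <= high_osc phi r s.
  by apply: sum_prefix_le => //; lia.
apply: (@le_trans _ _ (16 * (\sum_(0 <= j < H) P (j + m.+1)%N) +
   16 * (\sum_(0 <= j < H) P (j + 1)%N) + 2 * \sum_(0 <= j < H) Q j)); last by lra.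
rewrite !mulr_sumr -!big_split/=; apply: ler_sum_nat => j _.
have W0 := @adjacent_max_divn_le _ phi s (r - s) 0 j.
rewrite add0n subnK// in W0.
have V1 := adjacent_max_ge1 (r - s) s (j %/ 2 ^ s)%N phi1.
have near d : (d <= 2 ^ s)%N -> dyadic_avg phi s ((j + d) %/ 2 ^ s)%N <=
    adjacent_max phi r 0 j.
  move=> ds; apply: le_trans W0; have [||->|->] := @divn_add_near (2 ^ s) j d;
      rewrite ?expn_gt0//.
    exact: avg_le_adjacent_max.
  exact: avg_succ_le_adjacent_max.
have Wi : 0 <= (adjacent_max phi r 0 j)^-1 by rewrite invr_ge0; lra.
have := ler_wpM2r Wi (forward_avg_sub_dyadic_sqr phi j m0 ms sm).
move=> /le_trans; apply; rewrite 2!mulrDl -!(mulrA 16) -(mulrA 2) /P /Q.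
have inv_le (u v z : R) : 1 <= u -> u <= v -> z ^+ 2 / v <= z ^+ 2 / u.
  by move=> u1 uv; rewrite ler_wpM2l ?sqr_ge0// lef_pV2 ?posrE//; lra.
apply: lerD; first apply: lerD; rewrite ler_pM2l//; apply: inv_le => //.
  by apply: near; lia.
by apply: near; rewrite expn_gt0.
Qed.

(** * Oscillation of the dyadic martingale *)

(** Martingale transform of the averages, started at level k + t: each difference is
    divided by the weight c at the coarser level, which keeps the martingale
    property. *)
Fixpoint weighted_transform {R : realFieldType} (phi : nat -> R)
    (c : nat -> nat -> R) (t k n : nat) : R :=
  if t is t'.+1 then weighted_transform phi c t' k.+1 n./2 +
    (dyadic_avg phi k n - dyadic_avg phi k.+1 n./2) / c k.+1 n./2
  else 0.

Fixpoint weighted_transform_max {R : realFieldType} (phi : nat -> R)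
    (c : nat -> nat -> R) (t k n : nat) : R :=
  if t is t'.+1 then Num.max (weighted_transform_max phi c t' k.+1 n./2)
    `|weighted_transform phi c t k n|
  else 0.

Lemma weighted_transformS {R : realFieldType} (phi : nat -> R)
    (c : nat -> nat -> R) t k n :
  weighted_transform phi c t.+1 k n = weighted_transform phi c t k.+1 n./2 +
    (dyadic_avg phi k n - dyadic_avg phi k.+1 n./2) / c k.+1 n./2.
Proof. by []. Qed.

Lemma weighted_transform_max_ge0 {R : realFieldType} (phi : nat -> R)
    (c : nat -> nat -> R) t k n :
  0 <= weighted_transform_max phi c t k n.
Proof. by case: t => [|t] //=; rewrite le_max normr_ge0 orbT. Qed.

Lemma weighted_transform_le_max {R : realFieldType} (phi : nat -> R)
    (c : nat -> nat -> R) t k n :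
  `|weighted_transform phi c t k n| <= weighted_transform_max phi c t k n.
Proof. by case: t => [|t] /=; rewrite ?normr0// le_max lexx orbT. Qed.

Lemma weighted_transform_max_divn_le {R : realFieldType} (phi : nat -> R)
    (c : nat -> nat -> R) i t k n :
  weighted_transform_max phi c t (k + i) (n %/ 2 ^ i)%N <=
  weighted_transform_max phi c (t + i) k n.
Proof.
elim: i k n => [|i IH] k n; first by rewrite !addn0 divn1.
rewrite (addnS t i) expnS divnMA divn2 (_ : k + i.+1 = k.+1 + i)%N; last by lia.
by apply: le_trans (IH _ _) _; rewrite /= le_max lexx.
Qed.

(** Summation by parts: the differences of the averages are those of the transform
    multiplied by c, and c increases towards finer levels.  Comparing with c times
    the transform gives an error that is stable under the recursion. *)
Lemma abel_weighted_transform {R : realFieldType} (phi : nat -> R)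
    (c : nat -> nat -> R) r t k n :
  (forall k n, 0 < c k n) -> (forall k n, (k < r)%N -> c k.+1 n./2 <= c k n) ->
  (k + t <= r)%N ->
  `|dyadic_avg phi k n - dyadic_avg phi (k + t) (n %/ 2 ^ t)%N
     - c k n * weighted_transform phi c t k n| <=
  c k n * weighted_transform_max phi c t k n.
Proof.
move=> c0 cle; elim: t k n => [|t IH] k n ktr.
  by rewrite addn0 divn1 subrr !mulr0 subrr normr0.
have kr : (k < r)%N by lia.
have := IH k.+1 n./2 ltac:(lia).
have g0 := weighted_transform_max_ge0 phi c t k.+1 n./2.
have gm : `|weighted_transform phi c t.+1 k n| <= weighted_transform_max phi c t.+1 k n.
  exact: weighted_transform_le_max.
have gM : weighted_transform_max phi c t k.+1 n./2 <=
    weighted_transform_max phi c t.+1 k n.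
  by rewrite /= le_max lexx.
have gE : c k.+1 n./2 * weighted_transform phi c t.+1 k n =
    c k.+1 n./2 * weighted_transform phi c t k.+1 n./2 +
    (dyadic_avg phi k n - dyadic_avg phi k.+1 n./2).
  by rewrite weighted_transformS; field; rewrite gt_eqF.
have := cle _ n kr; have := c0 k.+1 n./2.
rewrite addSnnS expnS divnMA divn2.
move: gE; move: (dyadic_avg phi k n) (dyadic_avg phi k.+1 _)
    (dyadic_avg phi (k + t.+1) _).
move: gm gM g0.
move: (weighted_transform phi c t.+1 k n) (weighted_transform phi c t k.+1 n./2)
    (weighted_transform_max phi c t.+1 k n)
    (weighted_transform_max phi c t k.+1 n./2).
move: (c k n) (c k.+1 n./2) => C C' g g' G G' gG GG' G'0 x y z gE C'0 CC' h.
have -> : x - z - C * g = (y - z - C' * g') - (C - C') * g.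
  by have : C' * g = C' * g' + (x - y) by []; lra.
apply: le_trans (ler_normB _ _) _.
rewrite normrM (ger0_norm (_ : 0 <= C - C')); last by lra.
apply: (@le_trans _ _ (C' * G' + (C - C') * G)).
  by apply: lerD => //; apply: ler_wpM2l => //; lra.
nra.
Qed.

Lemma dyadic_osc_le_weighted_max {R : realFieldType} (phi : nat -> R)
    (c : nat -> nat -> R) r i t k n :
  (forall k n, 0 < c k n) -> (forall k n, (k < r)%N -> c k.+1 n./2 <= c k n) ->
  (k + t <= r)%N -> (i <= t)%N ->
  `|dyadic_avg phi (k + i) (n %/ 2 ^ i)%N - dyadic_avg phi k n| <=
  4 * (c k n * weighted_transform_max phi c t k n).
Proof.
move=> c0 cle ktr it.
have dist u l m : (l + u <= r)%N ->
    `|dyadic_avg phi l m - dyadic_avg phi (l + u) (m %/ 2 ^ u)%N| <=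
    2 * (c l m * weighted_transform_max phi c u l m).
  move=> lur; have := abel_weighted_transform phi m c0 cle lur.
  have := ler_wpM2l (ltW (c0 l m)) (weighted_transform_le_max phi c u l m).
  rewrite -[X in X * `|_|]gtr0_norm ?c0// -normrM.
  move: (c l m * weighted_transform_max _ _ _ _ _) (c l m * _) => M g.
  move: (dyadic_avg _ _ _ - _) => x h1 h2.
  have := ler_normD (x - g) g; rewrite subrK; lra.
have h1 := dist t k n ktr.
have h2 : `|dyadic_avg phi (k + i) (n %/ 2 ^ i)%N
    - dyadic_avg phi (k + t) (n %/ 2 ^ t)%N| <=
    2 * (c k n * weighted_transform_max phi c t k n).
  have := dist (t - i)%N (k + i)%N (n %/ 2 ^ i)%N ltac:(lia).
  rewrite -divnMA -expnD -addnA subnKC// => /le_trans; apply.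
  rewrite ler_pM2l//; apply: ler_pM => //.
  - exact/ltW.
  - exact: weighted_transform_max_ge0.
  - elim: i it n {h1} => [|i IH] it n; first by rewrite addn0 divn1.
    rewrite addnS expnSr divnMA divn2; apply: le_trans (IH _ n); last by lia.
    by apply: cle; lia.
  - have := weighted_transform_max_divn_le phi c i (t - i) k n.
    by rewrite subnK.
have -> : dyadic_avg phi (k + i) (n %/ 2 ^ i)%N - dyadic_avg phi k n =
  (dyadic_avg phi (k + i) (n %/ 2 ^ i)%N - dyadic_avg phi (k + t) (n %/ 2 ^ t)%N) -
  (dyadic_avg phi k n - dyadic_avg phi (k + t) (n %/ 2 ^ t)%N) by ring.
by apply: le_trans (ler_normB _ _) _; lra.
Qed.

Lemma weighted_transform_children {R : realFieldType} (phi : nat -> R)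
    (c : nat -> nat -> R) t k p :
  exists2 e, e = (dyadic_avg phi k p.*2 - dyadic_avg phi k p.*2.+1) / 2 / c k.+1 p &
  weighted_transform phi c t.+1 k p.*2 = weighted_transform phi c t k.+1 p + e /\
  weighted_transform phi c t.+1 k p.*2.+1 = weighted_transform phi c t k.+1 p - e.
Proof.
eexists; first reflexivity.
rewrite !weighted_transformS /= /coarsen doubleK uphalf_double.
by split; rewrite -?mulNr; congr +%R; congr *%R; field.
Qed.

(** L^2 inequality of Doob.  With G the maximal function and g the transform, the
    sum of 2 G |g| - G^2 is 0 at the coarsest level and increases towards finer
    levels, because |g| is a submartingale and 2 G' x - G'^2 >= 2 G x - G^2 for
    G' = max G x.  Hence sum G^2 <= 2 sum G |g|, and G |g| is split by completing a
    square. *)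
Lemma doob_weighted_transform {R : realFieldType} (phi : nat -> R)
    (c : nat -> nat -> R) r t k :
  (k + t <= r)%N ->
  \sum_(0 <= j < 2 ^ r) weighted_transform_max phi c t k (j %/ 2 ^ k)%N ^+ 2 <=
  4 * \sum_(0 <= j < 2 ^ r) weighted_transform phi c t k (j %/ 2 ^ k)%N ^+ 2.
Proof.
pose X t k n := 2 * weighted_transform_max phi c t k n
    * `|weighted_transform phi c t k n|
  - weighted_transform_max phi c t k n ^+ 2.
move=> ktr.
have : 0 <= \sum_(0 <= j < 2 ^ r) X t k (j %/ 2 ^ k)%N.
  elim: t k ktr => [|t IH] k ktr.
    by apply: sumr_ge0 => j _; rewrite /X /= mulr0 mul0r expr0n subr0.
  have kr : (k < r)%N by lia.
  rewrite (sum_coarsen (X t.+1 k) kr); apply: le_trans (IH k.+1 _) _; first by lia.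
  apply: ler_sum => j _; move: (j %/ _)%N => p.
  have [e _ [gl gr]] := weighted_transform_children phi c t k p.
  have Xge n : 2 * weighted_transform_max phi c t k.+1 n./2
      * `|weighted_transform phi c t.+1 k n|
      - weighted_transform_max phi c t k.+1 n./2 ^+ 2 <= X t.+1 k n.
    rewrite /X [weighted_transform_max _ _ t.+1 _ _]/=
        -[X in Num.max _ `|X|]/(weighted_transform phi c t.+1 k n).
    move: (weighted_transform_max phi c t k.+1 n./2) `|_| => M w.
    by case: (leP M w) => // _; have := sqr_ge0 (M - w); nra.
  have := Xge p.*2; have := Xge p.*2.+1;
      rewrite /coarsen [p.*2.+1./2]uphalf_double doubleK gl gr.
  have := weighted_transform_max_ge0 phi c t k.+1 p.
  move: (X t.+1 k _) (X t.+1 k _) => x y; rewrite /X.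
  move: (weighted_transform_max _ _ _ _ _) (weighted_transform _ _ _ _ _) => M g M0.
  have := ler_normD (g + e) (g - e); rewrite (_ : g + e + (g - e) = 2 * g);
      last by ring.
  rewrite normrM ger0_norm//.
  move: `|g + e| `|g - e| `|g| => u v w h;
      have : M * (2 * w) <= M * (u + v) by exact: ler_wpM2l.
  by lra.
have : \sum_(0 <= j < 2 ^ r) X t k (j %/ 2 ^ k)%N <=
   \sum_(0 <= j < 2 ^ r) (2 * weighted_transform phi c t k (j %/ 2 ^ k)%N ^+ 2
     - 2^-1 * weighted_transform_max phi c t k (j %/ 2 ^ k)%N ^+ 2).
  apply: ler_sum => j _; rewrite /X -[in leRHS]real_normK ?num_real//.
  have := sqr_ge0 (weighted_transform_max phi c t k (j %/ 2 ^ k)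
      - 2 * `|weighted_transform phi c t k (j %/ 2 ^ k)|).
  by rewrite !expr2; lra.
rewrite [Y in _ <= Y -> _]sumrB -!mulr_sumr; lra.
Qed.

(** Orthogonality of martingale differences: the energy of the transform is the sum
    of the energies of its differences, and the energy of a difference is at most
    dyadic_osc because c^2 dominates the average at the coarser level. *)
Lemma sum_weighted_transform_sqr {R : realFieldType} (phi : nat -> R)
    (c : nat -> nat -> R) r t k :
  (forall j, 1 <= phi j) ->
  (forall k n, (k <= r)%N -> dyadic_avg phi k n <= c k n ^+ 2) ->
  (k + t <= r)%N ->
  \sum_(0 <= j < 2 ^ r) weighted_transform phi c t k (j %/ 2 ^ k)%N ^+ 2 <=
  \sum_(k <= s < k + t) \sum_(0 <= j < 2 ^ r) dyadic_osc phi s (j %/ 2 ^ s.+1)%N.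
Proof.
move=> phi1 ac; elim: t k => [|t IH] k ktr.
  by rewrite addn0 big1 ?big_geq// => j _; rewrite /= expr0n.
have kr : (k < r)%N by lia.
rewrite (@sum_coarsen _ r k (fun n => weighted_transform phi c t.+1 k n ^+ 2))//.
rewrite [leRHS]big_ltn; last by lia.
apply: (@le_trans _ _ (\sum_(0 <= j < 2 ^ r) (dyadic_osc phi k (j %/ 2 ^ k.+1)%N
   + weighted_transform phi c t k.+1 (j %/ 2 ^ k.+1)%N ^+ 2))); last first.
  rewrite big_split/=; apply: lerD => //; rewrite -addSnnS; apply: IH; lia.
apply: ler_sum => j _; move: (j %/ _)%N => p; rewrite /coarsen.
have [e eE [-> ->]] := weighted_transform_children phi c t k p.
have -> x : ((x + e) ^+ 2 + (x - e) ^+ 2) / 2 = e ^+ 2 + x ^+ 2 by field.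
rewrite lerD2r eE exprMn /dyadic_osc exprVn ler_wpM2l ?sqr_ge0//.
have a1 := dyadic_avg_ge1 k.+1 p phi1; have := ac k.+1 p kr => h.
by rewrite lef_pV2 ?posrE//; lra.
Qed.

(** The weight is the square root of adjacent_max.  Its square dominates the averages,
    so the energy of the transform is at most that of the relative differences
    dyadic_osc, and dividing the squared oscillation by adjacent_max leaves only the
    maximal function of the transform. *)
Lemma block_dyadic_osc {R : realType} (phi : nat -> R) r k l :
  (forall j, 1 <= phi j) -> (k <= l)%N -> (l <= r)%N ->
  exists2 B : nat -> R,
    forall j s, (k <= s <= l)%N ->
      (dyadic_avg phi s (j %/ 2 ^ s)%N - dyadic_avg phi k (j %/ 2 ^ k)%N) ^+ 2
      / adjacent_max phi r 0 j <= B j &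
    \sum_(0 <= j < 2 ^ r) B j <= 64 *
      \sum_(k <= s < l) \sum_(0 <= j < 2 ^ r) dyadic_osc phi s (j %/ 2 ^ s.+1)%N.
Proof.
move=> phi1 kl lr.
pose c k n := Num.sqrt (adjacent_max phi (r - k) k n).
have W1 t m n := adjacent_max_ge1 t m n phi1.
have W0 t m n : 0 <= adjacent_max phi t m n by rewrite (le_trans ler01).
have c0 m n : 0 < c m n by rewrite sqrtr_gt0 (lt_le_trans ltr01).
have c2 m n : c m n ^+ 2 = adjacent_max phi (r - m) m n by rewrite sqr_sqrtr.
have cle m n : (m < r)%N -> c m.+1 n./2 <= c m n.
  by move=> mr; rewrite ler_sqrt// -(@subnSK m r)//; exact: adjacent_max_half_le.
have ac m n : (m <= r)%N -> dyadic_avg phi m n <= c m n ^+ 2.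
  by move=> _; rewrite c2 avg_le_adjacent_max.
exists (fun j => 16 * weighted_transform_max phi c (l - k) k (j %/ 2 ^ k)%N ^+ 2).
  move=> j s /andP[ks sl].
  have := @dyadic_osc_le_weighted_max _ phi c r (s - k) (l - k) k (j %/ 2 ^ k) c0
      cle ltac:(lia) ltac:(lia).
  rewrite -divnMA -expnD subnKC// => h.
  have W := @adjacent_max_divn_le _ phi k (r - k) 0 j.
  rewrite add0n subnK ?(leq_trans kl)// in W.
  rewrite ler_pdivrMr; last by rewrite (lt_le_trans ltr01).
  rewrite -real_normK ?num_real//.
  have G0 := weighted_transform_max_ge0 phi c (l - k) k (j %/ 2 ^ k).
  apply: le_trans (_ : _ <= (4 * (c k (j %/ 2 ^ k)%N
      * weighted_transform_max phi c (l - k) k (j %/ 2 ^ k)%N)) ^+ 2) _.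
    by rewrite lerXn2r ?nnegrE// mulr_ge0// mulr_ge0// ltW.
  rewrite !exprMn c2 -natrX mulrA mulrAC ler_wpM2l//.
  by rewrite mulr_ge0// sqr_ge0.
rewrite -mulr_sumr.
have := @doob_weighted_transform _ phi c r (l - k) k ltac:(lia).
have := @sum_weighted_transform_sqr _ phi c r (l - k) k phi1 ac ltac:(lia).
rewrite subnKC//; lra.
Qed.

(** * Lacunary sequences and dyadic scales *)

(** The level s with 2^(s-1) <= m < 2^s. *)
Definition dyadic_scale (m : nat) : nat := (trunc_log 2 m).+1.

Lemma dyadic_scaleP (m : nat) : (0 < m)%N ->
  (m < 2 ^ dyadic_scale m)%N /\ (2 ^ dyadic_scale m <= m.*2)%N.
Proof.
move=> m0; have /andP[h1 h2] := @trunc_log_bounds 2 m isT m0.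
by split=> //; rewrite expnS mul2n leq_double.
Qed.

Lemma dyadic_scale_homo : {homo dyadic_scale : m n / (m <= n)%N}.
Proof. by move=> m n mn; rewrite ltnS leq_trunc_log. Qed.

Lemma dyadic_scale_double (m : nat) : (0 < m)%N ->
  dyadic_scale m.*2 = (dyadic_scale m).+1.
Proof. by move=> m0; rewrite /dyadic_scale -mul2n trunc_logMp. Qed.

Lemma dyadic_scale_le (m r : nat) : (0 < m)%N -> (m < 2 ^ r)%N ->
  (dyadic_scale m <= r)%N.
Proof.
move=> m0 mr; have /andP[h _] := @trunc_log_bounds 2 m isT m0.
by rewrite -(@ltn_exp2l 2)//; exact: leq_ltn_trans mr.
Qed.

Lemma lacunary_ltn {R : realType} (u : nat -> nat) : lacunary R u ->
  forall i j, (i < j)%N -> (u i < u j)%N.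
Proof.
move=> [u0 [a a1 ua]]; apply: (@homo_ltn _ u (fun m n => (m < n)%N)) => [y x z|i];
    first exact: ltn_trans.
have := ua i; rewrite ler_pdivlMr ?ltr0n// -(ltr_nat R); apply: lt_le_trans.
by rewrite -[ltLHS]mul1r ltr_pM2r ?ltr0n.
Qed.

Lemma lacunary_gt_index {R : realType} (u : nat -> nat) : lacunary R u ->
  forall q, (q < u q)%N.
Proof.
move=> lac; elim=> [|q IH]; first by case: lac.
exact: leq_ltn_trans IH (lacunary_ltn lac (ltnSn q)).
Qed.

Lemma lacunary_double {R : realType} (u : nat -> nat) : lacunary R u ->
  exists c, forall q, ((u q).*2 <= u (q + c))%N.
Proof.
move=> [u0 [a a1 ua]].
have grow c q : a ^+ c * (u q)%:R <= (u (q + c)%N)%:R.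
  elim: c => [|c IH]; first by rewrite mul1r addn0.
  rewrite exprS -mulrA addnS.
  apply: (@le_trans _ _ (a * (u (q + c)%N)%:R));
      first by rewrite ler_pM2l// (lt_trans ltr01).
  by rewrite -ler_pdivlMr ?ltr0n.
have bernoulli c : 1 + c%:R * (a - 1) <= a ^+ c.
  elim: c => [|c IH]; first by rewrite mul0r addr0.
  have c0 : 0 <= c%:R * (a - 1) ^+ 2 by rewrite mulr_ge0// sqr_ge0.
  rewrite exprS; apply: (@le_trans _ _ (a * (1 + c%:R * (a - 1)))).
    by rewrite -natr1; lra.
  by rewrite ler_pM2l// (lt_trans ltr01).
have da : 0 < a - 1 by rewrite subr_gt0.
(* By the inequality of Bernoulli, a^c >= 2 as soon as c (a - 1) >= 1. *)
exists (Num.bound (a - 1)^-1) => q; set c := Num.bound _.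
have c1 : 1 <= c%:R * (a - 1).
  by rewrite -ler_pdivrMr// mul1r ltW// /c archi_boundP// invr_ge0 ltW.
rewrite -(ler_nat R); apply: le_trans (grow c q).
by rewrite -mul2n natrM ler_pM2r ?ltr0n//; have := bernoulli c; lra.
Qed.

(** If u doubles within c steps, two terms in the same dyadic block are fewer than c
    indices apart. *)
Lemma lacunary_scale_count {R : realType} (u : nat -> nat) : lacunary R u ->
  exists c : nat, forall s N,
    (\sum_(0 <= q < N) (dyadic_scale (u q) == s) <= c)%N.
Proof.
move=> lac; have [c uc] := lacunary_double lac; exists c => s N.
have mono i j : (i <= j)%N -> (dyadic_scale (u i) <= dyadic_scale (u j))%N.
  rewrite leq_eqVlt => /orP[/eqP->//|ij]; apply: dyadic_scale_homo.
  exact/ltnW/(lacunary_ltn lac).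
have jump q : (dyadic_scale (u q) < dyadic_scale (u (q + c)))%N.
  rewrite -dyadic_scale_double; first exact: dyadic_scale_homo.
  by case: lac.
have range_bound a b : (\sum_(a <= q < b) (dyadic_scale (u q) == s) <= b - a)%N.
  rewrite -[leqRHS]muln1 -sum_nat_const_nat; apply: leq_sum => q _; exact: leq_b1.
elim: N => [|N IH]; first by rewrite big_nil.
have [h|h] := eqVneq (dyadic_scale (u N)) s; last first.
  by rewrite big_nat_recr//= (negbTE h) addn0.
have [cN|Nc] := leqP c N.+1; last first.
  by apply: leq_trans (range_bound 0%N N.+1) _; rewrite subn0 ltnW.
(* The terms in question lie among the last c indices. *)
rewrite (@big_cat_nat _ _ _ (N.+1 - c))//=; last by rewrite leq_subr.
rewrite big_nat big1 ?add0n => [|q /= qN].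
  by apply: leq_trans (range_bound _ _) _; rewrite subKn.
have : (dyadic_scale (u q) < s)%N.
  by rewrite -h; apply: leq_trans (jump q) _; apply: mono; lia.
by case: eqP => // ->; rewrite ltnn.
Qed.

(** The same count for the terms of M listed by value; the term of index q exceeds q,
    so values below N come from indices below N. *)
Lemma scale_count_range (M : nat -> nat) (c : nat) :
  (forall q, (q < M q)%N) ->
  (forall s N, (\sum_(0 <= q < N) (dyadic_scale (M q) == s) <= c)%N) ->
  forall s N, (\sum_(0 <= m < N | m \in range M) (dyadic_scale m == s) <= c)%N.
Proof.
move=> Mq cnt s N; apply: leq_trans (cnt s N).
apply: (@leq_trans (\sum_(0 <= m < N) \sum_(0 <= q < N)
    ((M q == m) * (dyadic_scale m == s)))).
  rewrite big_mkcond/= big_nat [leqRHS]big_nat.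
  apply: leq_sum => m /= mN; case: ifPn => // /set_mem[q _ qm].
  rewrite (bigD1_seq q) ?mem_index_iota ?iota_uniq//=.
    by rewrite qm eqxx mul1n leq_addr.
  by apply: leq_trans mN; rewrite -qm ltnS ltnW.
rewrite exchange_big/=; apply: leq_sum => q _.
have [MN|NM] := ltnP (M q) N.
  rewrite (bigD1_seq (M q)) ?mem_index_iota ?iota_uniq//= eqxx mul1n big1 ?addn0//.
  by move=> m mq; rewrite eq_sym (negbTE mq).
rewrite big_nat big1// => m mN; case: eqP => [Mm|]; last by rewrite mul0n.
by move: mN; rewrite -Mm ltnNge NM.
Qed.

(** * The oscillation inequality for sequences *)

Lemma sum_comp_le {R : numDomainType} (P : pred nat) (v : nat -> nat)
    (G : nat -> R) (c N S : nat) : (forall s, 0 <= G s) ->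
  (forall i, (i < N)%N -> P i -> (v i < S)%N) ->
  (forall s, (\sum_(0 <= i < N | P i) (v i == s) <= c)%N) ->
  \sum_(0 <= i < N | P i) G (v i) <= c%:R * \sum_(0 <= s < S) G s.
Proof.
move=> G0 vS cnt.
have -> : \sum_(0 <= i < N | P i) G (v i) =
    \sum_(0 <= i < N | P i) \sum_(0 <= s < S) (v i == s)%:R * G s.
  rewrite big_nat_cond [RHS]big_nat_cond; apply: eq_bigr => i /andP[/andP[_ iN] Pi].
  rewrite (bigD1_seq (v i)) ?mem_index_iota ?iota_uniq ?vS//= eqxx mul1r big1 ?addr0//.
  by move=> s si; rewrite eq_sym (negbTE si) mul0r.
rewrite exchange_big/= mulr_sumr; apply: ler_sum => s _.
by rewrite -mulr_suml ler_wpM2r// -natr_sum ler_nat.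
Qed.

Lemma le_sum_term {R : numDomainType} (P : pred nat) (F : nat -> R) a b m :
  (forall i, 0 <= F i) -> (a <= m < b)%N -> P m ->
  F m <= \sum_(a <= i < b | P i) F i.
Proof.
move=> F0 mab Pm; rewrite big_mkcond (bigD1_seq m) ?mem_index_iota ?iota_uniq//= Pm.
by rewrite lerDl sumr_ge0// => i _; case: ifP.
Qed.

Definition block_osc {R : realType} (a : nat -> R) (n_ : nat -> nat)
    (M : set nat) (k : nat) : R :=
  \big[Num.max/0]_(n_ k <= m < n_ k.+1 | m \in M) (a m - a (n_ k)) ^+ 2.

Lemma block_osc_ge0 {R : realType} (a : nat -> R) n_ M k : 0 <= block_osc a n_ M k.
Proof. by rewrite /block_osc; elim/big_ind: _ => // [x y x0 y0|i _];
    rewrite ?le_max ?x0 ?sqr_ge0. Qed.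

Lemma block_osc_le {R : realType} (a : nat -> R) n_ M k (b : R) : 0 <= b ->
  (forall m, (n_ k <= m < n_ k.+1)%N -> m \in M -> (a m - a (n_ k)) ^+ 2 <= b) ->
  block_osc a n_ M k <= b.
Proof.
move=> b0 h; rewrite /block_osc big_nat_cond; elim/big_ind: _ => //.
  by move=> x y xb yb; rewrite ge_max xb yb.
by move=> m /andP[/h + mM]; apply.
Qed.

Lemma le_block_osc {R : realType} (a : nat -> R) n_ (M : set nat) k m :
  (n_ k <= m < n_ k.+1)%N -> m \in M -> (a m - a (n_ k)) ^+ 2 <= block_osc a n_ M k.
Proof.
move=> mk mM; rewrite /block_osc.
apply: (@le_bigmax_seq _ _ _ _ _ m (fun i => i \in M)
    (fun m => (a m - a (n_ k)) ^+ 2)) => //.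
by rewrite mem_index_iota.
Qed.

(** Oscillation operator for the exponent 2, over the first K blocks. *)
Definition square_osc {R : realType} (a : nat -> R) n_ M K : R :=
  Num.sqrt (\sum_(0 <= k < K) block_osc a n_ M k).

Lemma sum_blocks {V : nmodType} (P : pred nat) (G : nat -> V) (b : nat -> nat) K :
  (forall k, (b k <= b k.+1)%N) ->
  \sum_(0 <= k < K) \sum_(b k <= m < b k.+1 | P m) G m =
  \sum_(b 0%N <= m < b K | P m) G m.
Proof.
move=> bm; elim: K => [|K IH]; first by rewrite big_nil big_geq.
rewrite big_nat_recr//= IH -big_cat_nat//.
by elim: K {IH} => // K IH; apply: leq_trans (bm K).
Qed.

(** Cost of replacing one average of scale s by the dyadic average, with the constants
    of the comparison of one-sided and dyadic averages. *)
Definition scale_osc {R : realFieldType} (phi : nat -> R) (r s : nat) : R :=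
  32 * low_osc phi r s + 2 * high_osc phi r s.

Lemma sqr_dist3_le {R : realDomainType} (x y f g : R) :
  (x - y) ^+ 2 <= 3 * ((x - f) ^+ 2 + (y - g) ^+ 2 + (f - g) ^+ 2).
Proof.
have -> : x - y = (x - f) + (f - g) - (y - g) by ring.
move: (x - f) (f - g) (y - g) => u v w.
by have := sqr_ge0 (u - v); have := sqr_ge0 (v + w); have := sqr_ge0 (u + w); nra.
Qed.

(** Inside a block, A_m - A_n is split as (A_m - f_s) - (A_n - f_t) + (f_s - f_t), where
    s and t are the scales of m and n.  The supremum over m is replaced by a sum for
    the first part, which lacunarity makes affordable, and is a martingale
    oscillation for the last. *)
Lemma sum_block_osc_le {R : realType} (phi : nat -> R) (r k : nat)
    (n_ : nat -> nat) (M : set nat) :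
  (forall j, 1 <= phi j) -> (0 < n_ k)%N -> (n_ k < n_ k.+1)%N ->
  (n_ k.+1 <= 2 ^ r)%N ->
  \sum_(0 <= j < 2 ^ r)
    block_osc (fun m => forward_avg phi m j) n_ M k / adjacent_max phi r.+1 0 j <=
  3 * (\sum_(n_ k <= m < n_ k.+1 | m \in M) scale_osc phi r.+1 (dyadic_scale m)
    + scale_osc phi r.+1 (dyadic_scale (n_ k))
    + 64 * \sum_(dyadic_scale (n_ k) <= s < dyadic_scale (n_ k.+1))
         \sum_(0 <= j < 2 ^ r.+1) dyadic_osc phi s (j %/ 2 ^ s.+1)%N).
Proof.
move=> phi1 n0 nn nr; set G := scale_osc phi r.+1.
have kl : (dyadic_scale (n_ k) <= dyadic_scale (n_ k.+1))%N by
    exact/dyadic_scale_homo/ltnW.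
have lr : (dyadic_scale (n_ k.+1) <= r.+1)%N.
  apply: dyadic_scale_le; first exact: leq_ltn_trans nn.
  by rewrite (leq_ltn_trans nr)// ltn_exp2l.
have [B Bge Bsum] := block_dyadic_osc phi1 kl lr.
have W1 j : 1 <= adjacent_max phi r.+1 0 j by exact: adjacent_max_ge1.
have W0 j : 0 < adjacent_max phi r.+1 0 j by exact: lt_le_trans (W1 j).
(* Relative squared error of replacing A_m by the dyadic average of its scale. *)
pose E m j := (forward_avg phi m j
    - dyadic_avg phi (dyadic_scale m) (j %/ 2 ^ dyadic_scale m)%N) ^+ 2
    / adjacent_max phi r.+1 0 j.
have E0 m j : 0 <= E m j by rewrite divr_ge0 ?sqr_ge0// ltW.
have B0 j : 0 <= B j.
  by have := Bge j (dyadic_scale (n_ k)); rewrite leqnn kl subrr expr0n mul0r; apply.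
have EG m : (n_ k <= m < n_ k.+1)%N -> \sum_(0 <= j < 2 ^ r) E m j <=
    G (dyadic_scale m).
  move=> /andP[nm mn]; have m0 : (0 < m)%N by exact: leq_trans nm.
  have [h1 h2] := dyadic_scaleP m0.
  apply: sum_forward_avg_sub_dyadic => //.
    by apply: dyadic_scale_le => //; apply: (leq_trans mn);
        rewrite (leq_trans nr)// leq_exp2l.
  by rewrite expnS mul2n -addnn leq_add2l (leq_trans mn).
clearbody G.
apply: (@le_trans _ _ (\sum_(0 <= j < 2 ^ r)
   3 * (\sum_(n_ k <= m < n_ k.+1 | m \in M) E m j + E (n_ k) j + B j))).
  apply: ler_sum => j _; rewrite ler_pdivrMr//.
  have S0 : 0 <= \sum_(n_ k <= m < n_ k.+1 | m \in M) E m j by exact: sumr_ge0.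
  apply: block_osc_le.
    by apply: mulr_ge0; [rewrite mulr_ge0// !addr_ge0 | exact: ltW].
  move=> m mk mM; rewrite -ler_pdivrMr//.
  have Em : E m j <= \sum_(n_ k <= m < n_ k.+1 | m \in M) E m j.
    exact: (@le_sum_term _ (fun i => i \in M) (fun i => E i j)).
  have Bm := Bge j (dyadic_scale m).
  have {Bm} Bm := Bm ltac:(by case/andP: mk => h1 h2;
      rewrite !dyadic_scale_homo// ltnW).
  apply: (@le_trans _ _ (3 * (E m j + E (n_ k) j
      + (dyadic_avg phi (dyadic_scale m) (j %/ 2 ^ dyadic_scale m)%N
     - dyadic_avg phi (dyadic_scale (n_ k)) (j %/ 2 ^ dyadic_scale (n_ k))%N) ^+ 2
         / adjacent_max phi r.+1 0 j))); last by lra.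
  rewrite /E -!mulrDl mulrA ler_pM2r ?invr_gt0//.
  exact: sqr_dist3_le.
rewrite -mulr_sumr ler_pM2l// !big_split/=.
apply: lerD; first apply: lerD.
- rewrite exchange_big/= [leRHS]big_nat_cond [leLHS]big_nat_cond.
  by apply: ler_sum => m /andP[mk _]; exact: EG.
- by apply: EG; rewrite leqnn.
- by apply: le_trans Bsum; apply: sum_prefix_le; rewrite ?leq_exp2l.
Qed.

Lemma dyadic_scale_leS (m r : nat) : (0 < m)%N -> (m <= 2 ^ r)%N ->
  (dyadic_scale m <= r.+1)%N.
Proof. by move=> m0 mr; apply: dyadic_scale_le => //;
    rewrite (leq_ltn_trans mr)// ltn_exp2l. Qed.

(** Only half a period is summed on the left: windows that start in the first half
    and are no longer than half a period stay inside the period. *)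
Lemma sequence_oscillation_LlogL {R : realType} (n_ M : nat -> nat) :
  lacunary R n_ -> lacunary R M ->
  exists2 C : R, 0 <= C & forall (phi : nat -> R) (r K : nat),
    (forall j, phi (j + 2 ^ r.+1)%N = phi j) -> (forall j, 1 <= phi j) ->
    (n_ K <= 2 ^ r)%N ->
    \sum_(0 <= j < 2 ^ r)
      square_osc (fun m => forward_avg phi m j) n_ (range M) K <=
    C * \sum_(0 <= j < 2 ^ r.+1) (phi j + phi j * ln (phi j)).
Proof.
move=> n_lac M_lac.
have [c cn] := lacunary_scale_count n_lac.
have [c' cM] := lacunary_scale_count M_lac.
have cR := scale_count_range (lacunary_gt_index M_lac) cM.
have n0 k : (0 < n_ k)%N by case: n_lac.
have nlt := lacunary_ltn n_lac.
have nle k l : (k <= l)%N -> (n_ k <= n_ l)%N.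
  by rewrite leq_eqVlt => /orP[/eqP->//|/nlt/ltnW].
exists (2 + 9 * (160 * (c%:R + c'%:R) + 64)) => [|phi r K per phi1 nK].
  by rewrite addr_ge0// mulr_ge0// addr_ge0// mulr_ge0// addr_ge0.
have W1 j : 1 <= adjacent_max phi r.+1 0 j by exact: adjacent_max_ge1.
have W0 j : 0 < adjacent_max phi r.+1 0 j by exact: lt_le_trans (W1 j).
pose O j := \sum_(0 <= k < K) block_osc (fun m => forward_avg phi m j) n_ (range M) k.
have O0 j : 0 <= O j by apply: sumr_ge0 => k _; exact: block_osc_ge0.
pose D := \sum_(0 <= s < r.+1) \sum_(0 <= j < 2 ^ r.+1) dyadic_osc phi s
    (j %/ 2 ^ s.+1)%N.
have d0 s : 0 <= \sum_(0 <= j < 2 ^ r.+1) dyadic_osc phi s (j %/ 2 ^ s.+1)%N.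
  apply: sumr_ge0 => j _; rewrite divr_ge0 ?sqr_ge0//.
  exact: le_trans ler01 (dyadic_avg_ge1 s.+1 _ phi1).
pose G := scale_osc phi r.+1.
have G0 s : 0 <= G s.
  rewrite addr_ge0// mulr_ge0// sumr_ge0// => j _; rewrite divr_ge0 ?sqr_ge0//.
    exact: le_trans ler01 (dyadic_avg_ge1 s _ phi1).
  exact: le_trans ler01 (adjacent_max_ge1 _ s _ phi1).
have sumG : \sum_(0 <= s < r.+2) G s <= 160 * D.
  rewrite big_split/= -!mulr_sumr.
  have := sum_low_osc_le r.+1 phi1; have := sum_high_osc_le per phi1.
  by rewrite -/D; lra.
have blockO k : (k < K)%N -> _ := fun kK => sum_block_osc_le (range M) phi1 (n0 k)
  (nlt _ _ (ltnSn k)) (leq_trans (nle _ _ kK) nK).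
rewrite -/G in blockO; clearbody G.
have sumO : \sum_(0 <= j < 2 ^ r) O j / adjacent_max phi r.+1 0 j <=
    3 * (160 * (c%:R + c'%:R) + 64) * D.
  under eq_bigr do rewrite mulr_suml.
  rewrite exchange_big/=.
  apply: le_trans (ler_sum_nat _) _.
    by move=> k /andP[_ kK]; exact: blockO.
  rewrite -mulr_sumr -mulrA ler_pM2l// !big_split/=.
  have s1 : \sum_(0 <= k < K) \sum_(n_ k <= m < n_ k.+1 | m \in range M) G
      (dyadic_scale m)
      <= c'%:R * \sum_(0 <= s < r.+2) G s.
    rewrite (@sum_blocks _ (fun m => m \in range M) (fun m => G (dyadic_scale m)));
        last by move=> k; exact: nle.
    apply: (@le_trans _ _ (\sum_(0 <= m < n_ K | m \in range M) G (dyadic_scale m))).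
      rewrite [leRHS](@big_cat_nat _ _ _ (n_ 0))//=; last exact: nle.
      by rewrite lerDr sumr_ge0.
    apply: (@sum_comp_le _ (fun m => m \in range M) dyadic_scale G) => //.
    move=> m mK /set_mem[q _ qm]; rewrite ltnS; apply: dyadic_scale_leS.
      by rewrite -qm; case: M_lac.
    by rewrite (leq_trans _ nK)// ltnW.
  have s2 : \sum_(0 <= k < K) G (dyadic_scale (n_ k)) <=
      c%:R * \sum_(0 <= s < r.+2) G s.
    apply: (@sum_comp_le _ predT (fun k => dyadic_scale (n_ k)) G) => //.
    by move=> k kK _; rewrite ltnS; apply: dyadic_scale_leS => //;
        apply: leq_trans nK; exact/nle/ltnW.
  have s3 : \sum_(0 <= k < K) 64
      * \sum_(dyadic_scale (n_ k) <= s < dyadic_scale (n_ k.+1))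
      \sum_(0 <= j < 2 ^ r.+1) dyadic_osc phi s (j %/ 2 ^ s.+1)%N <= 64 * D.
    rewrite -mulr_sumr ler_pM2l//.
    rewrite (@sum_blocks _ predT _ (fun k => dyadic_scale (n_ k)));
        last by move=> k; exact/dyadic_scale_homo/nle.
    rewrite /D (@big_cat_nat _ _ _ (dyadic_scale (n_ K)) 0 r.+1)//=;
        last exact: dyadic_scale_leS.
    rewrite (@big_cat_nat _ _ _ (dyadic_scale (n_ 0)) 0 (dyadic_scale (n_ K)))//=;
        last exact/dyadic_scale_homo/nle.
    by rewrite -addrA addrCA lerDl addr_ge0// sumr_ge0.
  have c0 : 0 <= c%:R :> R by [].
  have c'0 : 0 <= c'%:R :> R by [].
  have := ler_wpM2l c0 sumG; have := ler_wpM2l c'0 sumG; lra.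
have sumD := sum_dyadic_osc_le r.+1 phi1.
have sumW := sum_adjacent_max_LlogL per phi1.
apply: (@le_trans _ _ (\sum_(0 <= j < 2 ^ r) (2^-1 * adjacent_max phi r.+1 0 j
    + 2^-1 * (O j / adjacent_max phi r.+1 0 j)))).
  apply: ler_sum => j _; rewrite /square_osc -/(O j).
  (* Arithmetic-geometric inequality for W and O / W. *)
  have OE : O j = adjacent_max phi r.+1 0 j * (O j / adjacent_max phi r.+1 0 j).
    by rewrite mulrC divfK// gt_eqF.
  have q0 : 0 <= O j / adjacent_max phi r.+1 0 j by rewrite divr_ge0// ltW.
  rewrite [in leLHS]OE; move: q0 (W0 j); move: (O j / _) => x;
      move: (adjacent_max _ _ _ _) => w x0 w0.
  rewrite sqrtrM ?(ltW w0)//.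
  rewrite -[in leRHS](sqr_sqrtr x0) -[in leRHS](sqr_sqrtr (ltW w0)).
  by have := sqr_ge0 (Num.sqrt x - Num.sqrt w); nra.
rewrite big_split/= -!mulr_sumr.
have sumW' : \sum_(0 <= j < 2 ^ r) adjacent_max phi r.+1 0 j <=
    \sum_(0 <= j < 2 ^ r.+1) adjacent_max phi r.+1 0 j.
  by apply: sum_prefix_le => [j|]; rewrite ?leq_exp2l// ltW.
have sumphi : \sum_(0 <= j < 2 ^ r.+1) (phi j * ln (phi j)) <=
    \sum_(0 <= j < 2 ^ r.+1) (phi j + phi j * ln (phi j)).
  by apply: ler_sum => j _; rewrite lerDr (le_trans ler01).
rewrite -/D in sumD.
have : (160 * (c%:R + c'%:R) + 64) * D <= (160 * (c%:R + c'%:R) + 64) *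
   (6 * \sum_(0 <= j < 2 ^ r.+1) (phi j + phi j * ln (phi j))).
  apply: ler_wpM2l; last by lra.
  by rewrite addr_ge0// mulr_ge0// addr_ge0.
lra.
Qed.

(** * From sequences to measure preserving maps *)

(** Lets the l^rho norm be bounded by the l^2 norm: b will be the l^2 norm itself. *)
Lemma powR_le_sqr {R : realType} (rho d b : R) : 2 <= rho -> 0 <= d -> d <= b ->
  d `^ rho <= b `^ (rho - 2) * d ^+ 2.
Proof.
move=> rho2 d0 db.
have -> : d `^ rho = d `^ (rho - 2) * d ^+ 2.
  rewrite -powR_mulrn// -powRD ?subrK//.
  by apply/implyP => /eqP; lra.
rewrite ler_wpM2r ?sqr_ge0// ge0_ler_powR ?nnegrE//; first by lra.
exact: le_trans db.
Qed.

Lemma oscillation_le {T : Type} {R : realType} (a : nat -> T -> R) n_ M (rho : R) x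
    (b : R) :
  2 <= rho ->
  (forall K, square_osc (fun m => a m x) n_ M K <= b) ->
  (oscillation a n_ M rho x <= b%:E)%E.
Proof.
move=> rho2 hb.
have b0 : 0 <= b by apply: le_trans (hb 0%N); exact: sqrtr_ge0.
have osc0 k : 0 <= block_osc (fun m => a m x) n_ M k by exact: block_osc_ge0.
have hb2 K : \sum_(0 <= k < K) block_osc (fun m => a m x) n_ M k <= b ^+ 2.
  by rewrite -[leLHS]sqr_sqrtr ?sumr_ge0// lerXn2r ?nnegrE ?sqrtr_ge0//; exact: hb.
have oscb k : block_osc (fun m => a m x) n_ M k <= b ^+ 2.
  by apply: le_trans (hb2 k.+1); rewrite big_nat_recr//= lerDr sumr_ge0.
rewrite /oscillation.
pose F k := (\big[Num.max/0]_(n_ k <= m < n_ k.+1 | m \in M)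
  (`|a m x - a (n_ k) x| `^ rho))%:E.
have F0 k : 0 <= \big[Num.max/0]_(n_ k <= m < n_ k.+1 | m \in M)
    (`|a m x - a (n_ k) x| `^ rho).
  by elim/big_ind: _ => // y z y0 _; rewrite le_max y0.
have Fle k : \big[Num.max/0]_(n_ k <= m < n_ k.+1 | m \in M)
    (`|a m x - a (n_ k) x| `^ rho) <=
    b `^ (rho - 2) * block_osc (fun m => a m x) n_ M k.
  rewrite big_nat_cond; elim/big_ind: _ => //.
  - by rewrite mulr_ge0// powR_ge0.
  - by move=> y z yb zb; rewrite ge_max yb zb.
  move=> m /andP[mk mM].
  have dle := le_block_osc (fun m => a m x) mk mM.
  apply: (@le_trans _ _ (b `^ (rho - 2) * `|a m x - a (n_ k) x| ^+ 2)).
    apply: powR_le_sqr => //.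
    rewrite -(ler_pXn2r (ltn0Sn 1)) ?nnegrE// real_normK ?num_real//.
    exact: le_trans dle (oscb k).
  by rewrite real_normK ?num_real// ler_wpM2l// powR_ge0.
have sumF : (\sum_(0 <= k <oo) F k <= (b `^ rho)%:E)%E.
  apply: lime_le; first by apply: is_cvg_nneseries => k _ _; rewrite /F lee_fin.
  apply: nearW => K; rewrite /F sumEFin lee_fin.
  apply: (@le_trans _ _ (b `^ (rho - 2) * b ^+ 2)).
    apply: (@le_trans _ _ (\sum_(0 <= k < K) b `^ (rho - 2)
        * block_osc (fun m => a m x) n_ M k)).
      exact: ler_sum.
    by rewrite -mulr_sumr ler_wpM2l// powR_ge0.
  rewrite -powR_mulrn// -powRD ?subrK//.
  by apply/implyP => /eqP; lra.
have -> : b%:E = ((b `^ rho)%:E `^ rho^-1)%E.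
  by rewrite poweR_EFin -powRrM mulfV ?powRr1// gt_eqF//; lra.
apply: (@gt0_ler_poweR _ _ _ (\sum_(0 <= k <oo) F k)%E) => //.
- by rewrite invr_ge0; lra.
- rewrite in_itv/= leey andbT; apply: nneseries_ge0 => k _ _; by rewrite /F lee_fin.
- by rewrite in_itv/= leey andbT lee_fin powR_ge0.
Qed.

Lemma square_osc_sub {R : realType} (a b b' : nat -> R) n_ M K :
  (forall m, a m = b m - b' m) ->
  square_osc a n_ M K <= 2 * (square_osc b n_ M K + square_osc b' n_ M K).
Proof.
move=> aE; rewrite /square_osc.
have h : \sum_(0 <= k < K) block_osc a n_ M k <=
   2 * \sum_(0 <= k < K) block_osc b n_ M k + 2 * \sum_(0 <= k < K) block_osc b' n_ M k.
  rewrite !mulr_sumr -big_split/=; apply: ler_sum => k _.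
  apply: block_osc_le => [|m mk mM];
      first by rewrite addr_ge0// mulr_ge0// block_osc_ge0.
  have := le_block_osc b mk mM; have := le_block_osc b' mk mM; rewrite !aE.
  have -> : b m - b' m - (b (n_ k) - b' (n_ k)) =
      (b m - b (n_ k)) - (b' m - b' (n_ k)) by ring.
  move: (b m - _) (b' m - _) => x y.
  by have := sqr_ge0 (x + y); nra.
apply: le_trans (ler_wsqrtr h) _.
have : 0 <= \sum_(0 <= k < K) block_osc b n_ M k by apply: sumr_ge0 => k _;
    exact: block_osc_ge0.
have : 0 <= \sum_(0 <= k < K) block_osc b' n_ M k by apply: sumr_ge0 => k _;
    exact: block_osc_ge0.
move: (\sum_(_ <= _ < _) _) (\sum_(_ <= _ < _) _) => x y x0 y0.
have sx := sqrtr_ge0 x; have sy := sqrtr_ge0 y.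
have p0 : 0 <= 2 * (Num.sqrt x + Num.sqrt y) by lra.
rewrite -(ler_pXn2r (ltn0Sn 1)) ?nnegrE ?sqrtr_ge0//.
rewrite sqr_sqrtr; last by lra.
have := sqr_sqrtr x0; have := sqr_sqrtr y0.
by move: (Num.sqrt x) (Num.sqrt y) sx sy {p0} => u w *; nra.
Qed.

Lemma eq_square_osc {R : realType} (a b : nat -> R) n_ M K :
  (forall i j, (i < j)%N -> (n_ i < n_ j)%N) ->
  (forall m, (m < n_ K)%N -> a m = b m) ->
  square_osc a n_ M K = square_osc b n_ M K.
Proof.
move=> nlt ab; congr Num.sqrt; rewrite big_nat [RHS]big_nat; apply: eq_bigr => k /= kK.
have nK : (n_ k.+1 <= n_ K)%N.
  by move: kK; rewrite leq_eqVlt => /orP[/eqP->//|/nlt/ltnW].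
rewrite /block_osc big_nat_cond [RHS]big_nat_cond;
    apply: eq_bigr => m /andP[/andP[_ mk] _].
by rewrite !ab//; [apply: leq_trans nK; exact: nlt | exact: leq_trans nK].
Qed.

Lemma iter_measurable d (T : measurableType d) (tau : T -> T) j :
  measurable_fun setT tau -> measurable_fun setT (iter j tau).
Proof.
move=> mt; elim: j => [|j IH]; first exact: measurable_id.
exact: (measurableT_comp mt IH).
Qed.

Lemma ge0_integral_iter d (T : measurableType d) (R : realType)
    (mu : {measure set T -> \bar R}) (tau : T -> T) (g : T -> \bar R) j :
  measurable_fun setT tau -> measure_preserving mu tau ->
  measurable_fun setT g -> (forall x, (0 <= g x)%E) ->
  (\int[mu]_x g (iter j tau x) = \int[mu]_x g x)%E.
Proof.
move=> mt mp mg g0; elim: j => // j <-.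
have mgj : measurable_fun setT (fun x => g (iter j tau x)).
  exact: (measurableT_comp mg (iter_measurable j mt)).
under eq_integral do rewrite iterSr.
rewrite -(@ge0_integral_pushforward _ _ _ _ _ tau mt mu setT
    (fun x => g (iter j tau x)))//.
by apply: eq_measure_integral => A mA _; exact: mp.
Qed.

Lemma measurable_ergodic_avg d (T : measurableType d) (R : realType)
    (tau : T -> T) (v : T -> R) m :
  measurable_fun setT tau -> measurable_fun setT v ->
  measurable_fun setT (ergodic_avg tau v m).
Proof.
move=> mt mv; apply: measurable_funM; first exact: measurable_cst.
apply: measurable_sum => k; exact: (measurableT_comp mv (iter_measurable k mt)).
Qed.

Lemma measurable_bigmax_nat d (T : measurableType d) (R : realType)
    (F : nat -> T -> R) (P : pred nat) (s : seq nat) :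
  (forall m, measurable_fun setT (F m)) ->
  measurable_fun setT (fun x => \big[Num.max/0]_(m <- s | P m) F m x).
Proof.
move=> mF; elim: s => [|m s IH].
  by under eq_fun do rewrite big_nil; exact: measurable_cst.
under eq_fun do rewrite big_cons.
by case: (P m) => //; exact: measurable_maxr.
Qed.

Lemma measurable_square_osc d (T : measurableType d) (R : realType)
    (a : nat -> T -> R) n_ M K :
  (forall m, measurable_fun setT (a m)) ->
  measurable_fun setT (fun x => square_osc (fun m => a m x) n_ M K).
Proof.
move=> ma; apply: (measurableT_comp (continuous_measurable_fun (@sqrt_continuous R))).
apply: measurable_sum => k; apply: measurable_bigmax_nat => m.
by apply: measurable_funX; exact: measurable_funB.
Qed.

Lemma measurable_oscillation d (T : measurableType d) (R : realType)
    (a : nat -> T -> R) n_ M (rho : R) :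
  (forall m, measurable_fun setT (a m)) ->
  measurable_fun setT (oscillation a n_ M rho).
Proof.
move=> ma; apply: (measurableT_comp (measurable_poweR _)).
apply: ge0_emeasurable_sum => [k x _ _|k _].
  by rewrite lee_fin; elim/big_ind: _ => // y z y0 _; rewrite le_max y0.
apply/measurable_EFinP; apply: measurable_bigmax_nat => m.
apply: (measurableT_comp (measurable_powR _)).
by apply: measurableT_comp => //; exact: measurable_funB.
Qed.

(** Transference.  For each x the sequence v (tau^j x), repeated with period 2^(r+1),
    has the same averages as v along the orbit when the window stays in the period.
    Integrating the inequality for sequences, every term of either sum has the same
    integral, and the numbers of terms differ by a factor 2. *)
Lemma integral_square_osc_le d (T : measurableType d) (R : realType)
    (mu : {measure set T -> \bar R}) (tau : T -> T) (n_ M : nat -> nat) :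
  measurable_fun setT tau -> measure_preserving mu tau ->
  lacunary R n_ -> lacunary R M ->
  exists2 C : R, 0 <= C & forall (v : T -> R) K,
    measurable_fun setT v -> (forall x, 1 <= v x) ->
    (\int[mu]_x (square_osc (fun m => ergodic_avg tau v m x) n_ (range M) K)%:E
     <= C%:E * \int[mu]_x (v x + v x * ln (v x))%:E)%E.
Proof.
move=> mt mp n_lac M_lac.
have [C C0 hC] := sequence_oscillation_LlogL n_lac M_lac.
exists (2 * C) => [|v K mv v1]; first by rewrite mulr_ge0.
pose O x := square_osc (fun m => ergodic_avg tau v m x) n_ (range M) K.
pose psi x := v x + v x * ln (v x).
have mO : measurable_fun setT (EFin \o O).
  by apply/measurable_EFinP/measurable_square_osc => m; exact: measurable_ergodic_avg.
have O0 x : (0 <= (O x)%:E)%E by rewrite lee_fin sqrtr_ge0.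
have mpsi : measurable_fun setT (EFin \o psi).
  apply/measurable_EFinP/measurable_funD => //; apply: measurable_funM => //.
  exact: (measurableT_comp (@measurable_ln R)).
have psi0 x : (0 <= (psi x)%:E)%E.
  by have := v1 x => v1x; rewrite lee_fin addr_ge0 ?mulr_ge0 ?ln_ge0// (le_trans ler01).
(* Any r with n_K <= 2^r works. *)
pose r := n_ K; have nK : (n_ K <= 2 ^ r)%N by exact/ltnW/ltn_expl.
have pw x : \sum_(0 <= j < 2 ^ r) O (iter j tau x) <=
    C * \sum_(0 <= j < 2 ^ r.+1) psi (iter j tau x).
  pose phi j := v (iter (j %% 2 ^ r.+1) tau x).
  have := hC phi r K _ (fun j => v1 _) nK.
  have -> : \sum_(0 <= j < 2 ^ r.+1) (phi j + phi j * ln (phi j)) =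
      \sum_(0 <= j < 2 ^ r.+1) psi (iter j tau x).
    by rewrite big_nat [RHS]big_nat; apply: eq_bigr => j /= jr; rewrite /phi modn_small.
  have -> : \sum_(0 <= j < 2 ^ r)
      square_osc (fun m => forward_avg phi m j) n_ (range M) K =
      \sum_(0 <= j < 2 ^ r) O (iter j tau x).
    rewrite big_nat [RHS]big_nat; apply: eq_bigr => j /= jr.
    apply: eq_square_osc => [|m mK]; first exact: lacunary_ltn n_lac.
    congr (_ * _); rewrite big_nat [RHS]big_nat; apply: eq_bigr => i /andP[_ im].
    rewrite /phi modn_small ?iterD// expnS; lia.
  by apply=> j; rewrite /phi modnDr.
have lhs : (\int[mu]_x (\sum_(0 <= j < 2 ^ r) O (iter j tau x))%:E =
    ((2 ^ r)%:R)%:E * \int[mu]_x (O x)%:E)%E.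
  under eq_integral do rewrite -sumEFin.
  rewrite ge0_integral_sum//; last first.
    by move=> j; exact: (measurableT_comp mO (iter_measurable j mt)).
  under eq_bigr do rewrite (ge0_integral_iter _ mt mp mO O0).
  by rewrite big_const_nat subn0 iter_addr addr0 mule_natl.
have rhs : (\int[mu]_x (C * \sum_(0 <= j < 2 ^ r.+1) psi (iter j tau x))%:E =
    C%:E * (((2 ^ r.+1)%:R)%:E * \int[mu]_x (psi x)%:E))%E.
  under eq_integral do rewrite EFinM -sumEFin.
  rewrite ge0_integralZl_EFin//; last 2 first.
    - by move=> x _; apply: sume_ge0.
    - by apply: emeasurable_sum => j;
        exact: (measurableT_comp mpsi (iter_measurable j mt)).
  congr (_ * _)%E; rewrite ge0_integral_sum//; last first.
    by move=> j; exact: (measurableT_comp mpsi (iter_measurable j mt)).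
  under eq_bigr do rewrite (ge0_integral_iter _ mt mp mpsi psi0).
  by rewrite big_const_nat subn0 iter_addr addr0 mule_natl.
have : (((2 ^ r)%:R)%:E * \int[mu]_x (O x)%:E <=
    C%:E * (((2 ^ r.+1)%:R)%:E * \int[mu]_x (psi x)%:E))%E.
  rewrite -lhs -rhs.
  apply: ge0_le_integral => //.
  - by move=> x _; rewrite lee_fin sumr_ge0// => j _; rewrite -lee_fin.
  - apply/measurable_EFinP; apply: measurable_sum => j.
    by apply/measurable_EFinP; exact: (measurableT_comp mO (iter_measurable j mt)).
  - apply/measurable_EFinP; apply: measurable_funM => //; apply: measurable_sum => j.
    by apply/measurable_EFinP; exact: (measurableT_comp mpsi (iter_measurable j mt)).
  - by move=> x _; rewrite lee_fin; exact: pw.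
rewrite expnS natrM EFinM.
have -> : (C%:E * (2%:R%:E * (2 ^ r)%:R%:E * \int[mu]_x (psi x)%:E) =
   (2 ^ r)%:R%:E * ((2 * C)%:E * \int[mu]_x (psi x)%:E))%E.
  by rewrite EFinM !muleA; congr (_ * _)%E; rewrite -!EFinM; congr EFin; ring.
by rewrite lee_pmul2l// lte_fin ltr0n expn_gt0.
Qed.

(** * Integrability of the oscillation *)

(** For w <= 3 the term (1 + w) ln (1 + w) is at most 4 * 3; for w >= 3 one has
    1 + w <= 2w and ln (1 + w) <= 2 ln w, and x ln x is increasing on [1, +oo).  The
    term 1 + w is at most 1 plus that same term. *)
Lemma entropy_le_LlogL {R : realType} (y w : R) : 0 <= w -> w <= `|y| ->
  (1 + w) + (1 + w) * ln (1 + w) <= 25 + 8 * Num.max (`|y| * ln `|y|) 0.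
Proof.
move=> w0 wy; set m := Num.max _ 0.
have m0 : 0 <= m by rewrite le_max lexx orbT.
have my : `|y| * ln `|y| <= m by rewrite le_max lexx.
have lnw : w <= (1 + w) * ln (1 + w).
  have inv0 : 0 < (1 + w)^-1 by rewrite invr_gt0; lra.
  have h : - 1 < (1 + w)^-1 - 1 by lra.
  have := le_ln1Dx h; rewrite [1 + _]addrC subrK lnV ?posrE; last by lra.
  have : (1 + w) * (1 + w)^-1 = 1 by rewrite divff// gt_eqF//; lra.
  by move: (1 + w)^-1 (ln _) => z l; nra.
suff : (1 + w) * ln (1 + w) <= 12 + 4 * m by lra.
have [w3|w3] := leP w 3.
  have : ln (1 + w) <= w by apply: le_ln1Dx; lra.
  by nra.
have lny : ln w <= ln `|y| by rewrite ler_ln ?posrE; lra.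
have ln0 : 0 <= ln w by apply: ln_ge0; lra.
have : ln (1 + w) <= 2 * ln w.
  have wpos : 0 < w by lra.
  have -> : 2 * ln w = ln (w ^+ 2) by rewrite lnXn// mulr_natl.
  by rewrite ler_ln ?posrE; nra.
have h : w * ln w <= `|y| * ln `|y| by apply: ler_pM => //; lra.
by nra.
Qed.

Lemma integral_entropy_lty d (T : measurableType d) (R : realType)
    (mu : probability T R) (f u : T -> R) :
  measurable_fun setT u -> (forall x, 0 <= u x) -> (forall x, u x <= `|f x|) ->
  mu.-integrable setT (EFin \o (fun x => `|f x| * ln `|f x|)^\+) ->
  (\int[mu]_x ((1 + u x) + (1 + u x) * ln (1 + u x))%:E < +oo)%E.
Proof.
move=> mu_ u0 uf fL.
pose g := EFin \o (fun x => `|f x| * ln `|f x|)^\+.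
have g0 x : (0 <= g x)%E by rewrite lee_fin /funrpos le_max lexx orbT.
have [mg ig] := integrableP _ _ _ fL.
have {}ig : (\int[mu]_x g x < +oo)%E.
  by move: ig; under eq_integral do rewrite gee0_abs//.
have m1u : measurable_fun setT (fun x => 1 + u x) by exact: measurable_funD.
apply: (@le_lt_trans _ _ (\int[mu]_x ((25)%:E + 8%:E * g x))%E).
  apply: ge0_le_integral => //.
  - move=> x _; rewrite lee_fin addr_ge0 ?mulr_ge0 ?ln_ge0 ?addr_ge0//.
    by rewrite lerDl.
  - apply/measurable_EFinP/measurable_funD => //; apply: measurable_funM => //.
    exact: (measurableT_comp (@measurable_ln R)).
  - by apply: emeasurable_funD => //; exact: measurable_funeM.
  - by move=> x _; rewrite /g /= -EFinM -EFinD lee_fin; exact: entropy_le_LlogL.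
rewrite ge0_integralD//; last 2 first.
  - by move=> x _; rewrite mule_ge0.
  - exact: measurable_funeM.
rewrite integral_cst// ge0_integralZl_EFin//.
apply: lte_add_pinfty; last exact: lte_mul_pinfty.
by apply: lte_mul_pinfty => //;
    apply: le_lt_trans (probability_le1 mu measurableT) _; exact: ltry.
Qed.

Unset Implicit Arguments.

Theorem theorem5 (R : realType) (d : measure_display) (T : measurableType d)
    (mu : probability T R) (tau : T -> T)
    (tau_meas : measurable_fun setT tau) (tau_inv : bijective tau)
    (tau_mp : measure_preserving mu tau)
    (rho : R) (rho_ge2 : 2 <= rho)
    (n_ M : nat -> nat) (n_lac : lacunary R n_) (M_lac : lacunary R M)
    (f : T -> R) (f_meas : measurable_fun setT f)
    (f_LlogL : mu.-integrable setT
       (EFin \o (fun x => `|f x| * ln `|f x|)^\+)) :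
  mu.-integrable setT (oscillation (ergodic_avg tau f) n_ (range M) rho).
Proof.
have mavg (v : T -> R) m : measurable_fun setT v -> measurable_fun setT
    (ergodic_avg tau v m).
  by move=> mv; exact: measurable_ergodic_avg.
pose O (v : T -> R) K x := square_osc (fun m => ergodic_avg tau v m x) n_ (range M) K.
have mO v K : measurable_fun setT v -> measurable_fun setT (fun x => (O v K x)%:E).
  by move=> mv; apply/measurable_EFinP/measurable_square_osc => m; exact: mavg.
have O0 v K x : (0 <= (O v K x)%:E)%E by rewrite lee_fin sqrtr_ge0.
pose p x := Num.max (f x) 0; pose q x := Num.max (- f x) 0.
have mp : measurable_fun setT p by exact: measurable_maxr.
have mq : measurable_fun setT q by apply: measurable_maxr => //;
    exact: measurableT_comp.
have p0 x : 0 <= p x by rewrite le_max lexx orbT.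
have q0 x : 0 <= q x by rewrite le_max lexx orbT.
have pf x : p x <= `|f x| by rewrite ge_max normr_ge0 ler_norm.
have qf x : q x <= `|f x| by rewrite ge_max normr_ge0 -normrN ler_norm.
have fE x : f x = (1 + p x) - (1 + q x).
  by rewrite /p /q; case: (leP (f x) 0) => h; case: (leP (- f x) 0) => h'; lra.
(* The constants added to the two parts of f cancel. *)
have avgE m x : ergodic_avg tau f m x =
    ergodic_avg tau (fun x => 1 + p x) m x - ergodic_avg tau (fun x => 1 + q x) m x.
  by rewrite /ergodic_avg -mulrBr -sumrB; congr (_ * _); apply: eq_bigr => k _;
      exact: fE.
have [C C0 hC] := integral_square_osc_le tau_meas tau_mp n_lac M_lac.
have bound (u : T -> R) : measurable_fun setT u -> (forall x, 0 <= u x) ->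
    (forall x, u x <= `|f x|) ->
    exists2 A : R, 0 <= A & forall K,
        (\int[mu]_x (O (fun x => 1 + u x) K x)%:E <= A%:E)%E.
  move=> mu_ u0 uf.
  have lty := integral_entropy_lty mu_ u0 uf f_LlogL.
  have pos : (0 <= \int[mu]_x ((1 + u x) + (1 + u x) * ln (1 + u x))%:E)%E.
    apply: integral_ge0 => x _; rewrite lee_fin addr_ge0 ?mulr_ge0 ?ln_ge0 ?addr_ge0//.
    by rewrite lerDl.
  exists (C * fine (\int[mu]_x ((1 + u x) + (1 + u x) * ln (1 + u x))%:E)%E).
    by rewrite mulr_ge0// fine_ge0.
  move=> K; rewrite EFinM fineK ?ge0_fin_numE//.
  apply: hC => [|x]; first exact: measurable_funD.
  by rewrite lerDl.
have [A A0 hA] := bound p mp p0 pf.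
have [B B0 hB] := bound q mq q0 qf.
have intO K : (\int[mu]_x (O f K x)%:E <= (2 * (A + B))%:E)%E.
  apply: (@le_trans _ _ (\int[mu]_x (2%:E * ((O (fun x => (1 + p x)%R) K x)%:E
      + (O (fun x => (1 + q x)%R) K x)%:E)))%E).
    apply: ge0_le_integral => //.
    - exact: mO.
    - apply: measurable_funeM; apply: emeasurable_funD; apply: mO;
        exact: measurable_funD.
    - by move=> x _; rewrite -EFinD -EFinM lee_fin; exact: square_osc_sub.
  have m1p : measurable_fun setT (fun x => 1 + p x) by exact: measurable_funD.
  have m1q : measurable_fun setT (fun x => 1 + q x) by exact: measurable_funD.
  rewrite ge0_integralZl_EFin//; last 2 first.
    - by move=> x _; rewrite adde_ge0.
    - by apply: emeasurable_funD; exact: mO.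
  rewrite EFinM lee_pmul2l// ge0_integralD//; try exact: mO.
  by rewrite EFinD leeD.
have ndO x : {homo (fun K => (O f K x)%:E) : n m / (n <= m)%N >-> (n <= m)%E}.
  move=> K L KL; rewrite lee_fin; apply: ler_wsqrtr.
  by apply: sum_prefix_le => // k; exact: block_osc_ge0.
have mf := fun K => mO f K f_meas.
apply/integrableP; split; first by apply: measurable_oscillation => m; exact: mavg.
have osc0 x : (0 <= oscillation (ergodic_avg tau f) n_ (range M) rho x)%E by exact:
    poweR_ge0.
under eq_integral do rewrite gee0_abs//.
have mlim : measurable_fun setT (fun x => limn (fun K => (O f K x)%:E)).
  apply: (emeasurable_fun_cvg (fun K x => (O f K x)%:E)) => [K|x _]; first exact: mf.
  by apply/cvg_ex; eexists; exact: ereal_nondecreasing_cvgn (ndO x).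
apply: (@le_lt_trans _ _ (\int[mu]_x limn (fun K => (O f K x)%:E))%E).
  apply: ge0_le_integral => //.
  - by apply: measurable_oscillation => m; exact: mavg.
  move=> x _.
  rewrite (cvg_lim _ (ereal_nondecreasing_cvgn (ndO x)))//.
  have ub K : ((O f K x)%:E <= ereal_sup (range (fun K => (O f K x)%:E)))%E.
    by apply: ereal_sup_ubound; exists K.
  (* The pointwise bound needs a real number, the limit of the square functions. *)
  move: ub; case: (ereal_sup _) => [b|_|/(_ 0%N)]; last by rewrite leeNy_eq.
    by move=> ub; apply: oscillation_le => // K; rewrite -lee_fin; exact: ub.
  by rewrite leey.
have cv := cvg_monotone_convergence (mu := mu) measurableT mf
    (fun K x _ => O0 f K x) (fun x _ => ndO x).
rewrite -(cvg_lim _ cv)//.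
apply: (@le_lt_trans _ _ (2 * (A + B))%:E); last exact: ltry.
apply: lime_le; first by apply/cvg_ex; eexists; exact: cv.
exact: nearW.
Qed.
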